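(* There is no sound and complete qualitative simulator for the class of all inputs $(M,\rho_0,s_0)$ whose model $M$ (which may have several operating regions with transitions between them) uses only constraints of the types \emph{add} and \emph{constant}. That is, no algorithm meets the sound-and-complete output specification (given in the context) on every such input.
   Context: **Syntax.** A model $M$ has finitely many variables. Each variable $X$ has a quantity space: a finite strictly increasing list of landmark symbols, each denoting a fixed but possibly unspecified extended real. The landmark $0$ denotes the number $0$. The symbols $-\infty,\infty$ may occur only as first/last landmark and are always unreachable values; a finite first or last landmark may also be declared unreachable. A quantity space may span only a part of the line, e.g. $[0,\infty)$. The qualitative magnitude of $X$ is either a reachable landmark of $X$ or an open interval between adjacent landmarks; its qualitative direction is the sign of $dX/dt$: inc ($+$), dec ($-$), std ($0$). A qualitative value is a pair $\langle\text{magnitude},\text{direction}\rangle$; a state gives a qualitative value to every variable. Constraint types: add: $X(t)+Y(t)=Z(t)$; mult: $X(t)\times Y(t)=Z(t)$; constant: $dX/dt=0$, optionally with $X$ equal to a specified landmark; derivative: $dX/dt=Y(t)$. Arguments may repeat. A constraint other than derivative may come with correspondences: tuples of landmarks of its variables required to satisfy the same relation. $M$ has finitely many operating regions. Each region has a finite set of constraints and a finite list of transitions. A transition consists of: a trigger (Boolean combination of primitives ''variable = qualitative value''); a target region; the list of variables inheriting their magnitudes and the list of those inheriting their directions; and explicit qualitative values asserted for some variables after the transition. An input is $(M,\rho_0,s_0)$: a model, an initial region, and an initial state. **Semantics.** A trajectory consists of an assignment of (extended) real values to all landmarks that respects the order of each quantity space and satisfies all correspondences of every region the trajectory visits, together with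 a finite or infinite sequence of segments, each in one region, the first in $\rho_0$. Using a local clock, a segment is given by real-valued continuously differentiable functions of time for all variables, satisfying the region's constraints at all times and staying within the reachable part of their quantity spaces. A segment is either (a) on $[0,b]$ with $0<b\le\infty$, with finitely many changes of qualitative state, where if $b=\infty$ the values at $\infty$ are the limits of the variables and their derivatives, which must exist, be finite and reachable; or (b) on $[0,\infty)$ with infinitely many changes of qualitative state, finitely many in bounded time. The first segment has state $s_0$ at its start. No trigger of the region holds at any local time $t$ with $0<t<b$ (with $b=\infty$ in case (b)). For a segment of type (a): if a trigger holds at $b$, a transition with a true trigger is taken and the next segment is in its target region, its initial values satisfying that region's constraints and the asserted values, variables inheriting magnitudes keeping their exact real values and those inheriting directions keeping the sign of their derivatives (triggers are not tested at the entry point itself). If no trigger holds at $b$, the segment is the last one, and either $b=\infty$, or at $b$ some variable is at the first (last) landmark of its quantity space with direction dec (inc), i.e. is about to leave its quantity space. A segment of type (b) is the last one. The behavior of a trajectory is its sequence of states (labelled by regions): alternately the state at a time point and the state on the following open time interval on which the state stays constant, with a transition recorded as two consecutive time-point states. The behavior tree of an input consists of all finite prefixes of behaviors of trajectories of that input (its root is the initial state); it is empty exactly when the input has no trajectory (the initial state is inconsistent). **Sound-and-complete output specification.** On a given input the algorithm must: if the behavior tree is empty, report inconsistency in finite time; if it is nonempty and finite, print exactly the behaviors forming its branches in finite time; if it is infinite, run forever printing exactly the nodes of the tree one by one, in an order in which the root is first and no node is printed before its ancestors, so that for every $i$ the first $i$ nodes have been printed after finitely many steps. *)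

(* Defs.v *)
From Stdlib Require List.
From HB Require Import structures.
From mathcomp Require Import all_boot all_order all_algebra.
From mathcomp Require Import boolp classical_sets cardinality reals ereal.
From mathcomp Require Import topology normedtype.

Set Implicit Arguments.
Unset Strict Implicit.
Unset Printing Implicit Defensive.

Import Order.TTheory GRing.Theory Num.Theory.
Import numFieldNormedType.Exports.
Local Open Scope classical_set_scope.
Local Open Scope nat_scope.

(** * Syntax of qualitative models

    Variables, regions and landmarks are referred to by position: variable [v]
    has the quantity space [nth _ (m_vars M) v], and landmark [i] of [v] is the
    [i]-th entry of that quantity space.  Landmarks of different variables are
    therefore different symbols; they are related by constraints and
    correspondences only. *)

(* [LNamed] is a landmark denoting an unspecified finite number. *)
Inductive landmark := LMinusInf | LZero | LNamed | LPlusInf.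

Definition nat_of_landmark l :=
  match l with LMinusInf => 0 | LZero => 1 | LNamed => 2 | LPlusInf => 3 end.
Definition landmark_of_nat n :=
  match n with 0 => LMinusInf | 1 => LZero | 2 => LNamed | _ => LPlusInf end.
Lemma nat_of_landmarkK : cancel nat_of_landmark landmark_of_nat.
Proof. by case. Qed.
HB.instance Definition _ := Equality.copy landmark (can_type nat_of_landmarkK).

(* [qs_lo] and [qs_hi] tell whether the first, resp. last, landmark is
   reachable when it is finite. *)
Record qspace := QSpace {
  qs_lms : seq landmark;
  qs_lo : bool;
  qs_hi : bool }.

(* [At i] is landmark [i]; [Between i] is the open interval between landmarks
   [i] and [i.+1]. *)
Inductive mag := At of nat | Between of nat.

Definition sum_of_mag m : nat + nat :=
  match m with At i => inl i | Between i => inr i end.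
Definition mag_of_sum s :=
  match s with inl i => At i | inr i => Between i end.
Lemma sum_of_magK : cancel sum_of_mag mag_of_sum.
Proof. by case. Qed.
HB.instance Definition _ := Equality.copy mag (can_type sum_of_magK).

Inductive dir := Inc | Dec | Std.

Definition nat_of_dir d := match d with Inc => 0 | Dec => 1 | Std => 2 end.
Definition dir_of_nat n := match n with 0 => Inc | 1 => Dec | _ => Std end.
Lemma nat_of_dirK : cancel nat_of_dir dir_of_nat.
Proof. by case. Qed.
HB.instance Definition _ := Equality.copy dir (can_type nat_of_dirK).

Definition qval : Type := (mag * dir)%type.

(* The [v]-th entry is the qualitative value of variable [v]. *)
Definition state : Type := seq qval.

(* [CAdd x y z cs] is X + Y = Z and [CMult x y z cs] is X * Y = Z;
   [CConst x o cs] is dX/dt = 0, together with X = l when [o = Some l];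
   [CDeriv x y] is dX/dt = Y.  The lists [cs] are the correspondences. *)
Inductive constr :=
| CAdd of nat & nat & nat & seq (nat * nat * nat)
| CMult of nat & nat & nat & seq (nat * nat * nat)
| CConst of nat & option nat & seq nat
| CDeriv of nat & nat.

Inductive trigger :=
| TPrim of nat & qval
| TNot of trigger
| TAnd of trigger & trigger
| TOr of trigger & trigger.

Record transition := Transition {
  tr_trigger : trigger;
  tr_target : nat;
  tr_inh_mag : seq nat;
  tr_inh_dir : seq nat;
  tr_assert : seq (nat * qval) }.

Record region := Region {
  rg_constrs : seq constr;
  rg_trans : seq transition }.

Record model := Model {
  m_vars : seq qspace;
  m_regions : seq region }.

Record qinput := QInput {
  in_model : model;
  in_region : nat;
  in_state : state }.

Definition nvars M := size (m_vars M).
Definition qs_of M v := nth (QSpace [::] false false) (m_vars M) v.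
Definition region_of M r := nth (Region [::] [::]) (m_regions M) r.

(** ** Well-formedness *)

Definition wf_qspace (q : qspace) : bool :=
  let s := qs_lms q in
  [&& 0 < size s,
      all (fun i => (nth LZero s i == LMinusInf) ==> (i == 0))
          (iota 0 (size s)),
      all (fun i => (nth LZero s i == LPlusInf) ==> (i.+1 == size s))
          (iota 0 (size s))
    & count_mem LZero s <= 1].

Definition is_lm M v i : bool := i < size (qs_lms (qs_of M v)).

Definition reachable (q : qspace) i : bool :=
  [&& i < size (qs_lms q),
      nth LZero (qs_lms q) i \in [:: LZero; LNamed],
      (i == 0) ==> qs_lo q
    & (i.+1 == size (qs_lms q)) ==> qs_hi q].

Definition wf_mag (q : qspace) (m : mag) : bool :=
  match m with
  | At i => reachable q i
  | Between i => i.+1 < size (qs_lms q)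
  end.

Definition wf_assign M (a : nat * qval) : bool :=
  (a.1 < nvars M) && wf_mag (qs_of M a.1) a.2.1.

Definition wf_state M (s : state) : bool :=
  (size s == nvars M) &&
  all (fun v => wf_mag (qs_of M v) (nth (At 0, Std) s v).1) (iota 0 (nvars M)).

Definition wf_corr3 M x y z (c : nat * nat * nat) : bool :=
  [&& is_lm M x c.1.1, is_lm M y c.1.2 & is_lm M z c.2].

Definition wf_constr M (c : constr) : bool :=
  match c with
  | CAdd x y z cs | CMult x y z cs =>
      [&& x < nvars M, y < nvars M, z < nvars M & all (wf_corr3 M x y z) cs]
  | CConst x o cs =>
      [&& x < nvars M, (if o is Some l then is_lm M x l else true)
        & all (is_lm M x) cs]
  | CDeriv x y => (x < nvars M) && (y < nvars M)
  end.

Fixpoint wf_trigger M (g : trigger) : bool :=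
  match g with
  | TPrim v q => wf_assign M (v, q)
  | TNot g1 => wf_trigger M g1
  | TAnd g1 g2 | TOr g1 g2 => wf_trigger M g1 && wf_trigger M g2
  end.

Definition wf_transition M (tr : transition) : bool :=
  [&& wf_trigger M (tr_trigger tr),
      tr_target tr < size (m_regions M),
      all (fun v => v < nvars M) (tr_inh_mag tr),
      all (fun v => v < nvars M) (tr_inh_dir tr)
    & all (wf_assign M) (tr_assert tr)].

Definition wf_model M : bool :=
  all wf_qspace (m_vars M) &&
  all (fun r => all (wf_constr M) (rg_constrs r) &&
                all (wf_transition M) (rg_trans r)) (m_regions M).

Definition wf_input (I : qinput) : bool :=
  [&& wf_model (in_model I),
      in_region I < size (m_regions (in_model I))
    & wf_state (in_model I) (in_state I)].

Definition is_add_or_const (c : constr) : bool :=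
  match c with CAdd _ _ _ _ | CConst _ _ _ => true | _ => false end.

Definition add_const_only (M : model) : bool :=
  all (fun r => all is_add_or_const (rg_constrs r)) (m_regions M).

(** * Semantics *)

(* An entry of a behavior: the region, whether the state holds on an open
   interval ([true]) or at a time point ([false]), and the state. *)
Definition item : Type := (nat * bool * state)%type.
Definition behavior : Type := seq item.

Section Semantics.
Variable R : realType.

Definition dir_of (d : R) : dir :=
  if (0 < d)%R then Inc else if (d < 0)%R then Dec else Std.

(* [lam v i] is the value of landmark [i] of variable [v]. *)
Definition lm_assignment := nat -> nat -> \bar R.

Definition lm_denotes (l : landmark) (x : \bar R) : Prop :=
  match l with
  | LMinusInf => x = -oo%E
  | LZero => x = 0%E
  | LNamed => x \is a fin_num
  | LPlusInf => x = +oo%E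
  end.

Definition good_lms M (lam : lm_assignment) : Prop :=
  forall v, v < nvars M ->
    (forall i, is_lm M v i ->
       lm_denotes (nth LZero (qs_lms (qs_of M v)) i) (lam v i)) /\
    (forall i j, i < j -> is_lm M v j -> (lam v i < lam v j)%E).

(* Correspondences may involve infinite landmarks, for which a sum or product
   counts only when it is defined (no oo - oo, no 0 * oo). *)
Definition corr_holds (lam : lm_assignment) (c : constr) : Prop :=
  match c with
  | CAdd x y z cs => forall p, p \in cs ->
      (lam x p.1.1 +? lam y p.1.2)%E /\
      (lam x p.1.1 + lam y p.1.2)%E = lam z p.2
  | CMult x y z cs => forall p, p \in cs ->
      (lam x p.1.1 *? lam y p.1.2)%E /\
      (lam x p.1.1 * lam y p.1.2)%E = lam z p.2
  | CConst x (Some l) cs => forall i, i \in cs -> lam x i = lam x l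
  | CConst _ None _ => True
  | CDeriv _ _ => True
  end.

Definition mag_holds (lam : lm_assignment) v (m : mag) (x : R) : Prop :=
  match m with
  | At i => x%:E = lam v i
  | Between i => (lam v i < x%:E)%E /\ (x%:E < lam v i.+1)%E
  end.

(* Variable [v] has value [x], derivative [d] and qualitative value [q]. *)
Definition qval_holds M lam v (q : qval) (x d : R) : Prop :=
  [/\ wf_mag (qs_of M v) q.1, mag_holds lam v q.1 x & q.2 = dir_of d].

(* [x] and [d] give the values and the derivatives of all variables at one
   instant.  In particular all values are then in the reachable parts of the
   quantity spaces. *)
Definition state_holds M lam (s : state) (x d : nat -> R) : Prop :=
  size s = nvars M /\
  forall v, v < nvars M -> qval_holds M lam v (nth (At 0, Std) s v) (x v) (d v).

Fixpoint trigger_holds M lam (g : trigger) (x d : nat -> R) : Prop :=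
  match g with
  | TPrim v q => qval_holds M lam v q (x v) (d v)
  | TNot g1 => ~ trigger_holds M lam g1 x d
  | TAnd g1 g2 => trigger_holds M lam g1 x d /\ trigger_holds M lam g2 x d
  | TOr g1 g2 => trigger_holds M lam g1 x d \/ trigger_holds M lam g2 x d
  end.

Definition constr_holds (lam : lm_assignment) (c : constr) (x d : nat -> R) :
    Prop :=
  match c with
  | CAdd a b e _ => (x a + x b = x e)%R
  | CMult a b e _ => (x a * x b = x e)%R
  | CConst a o _ => d a = 0%R /\ (if o is Some l then (x a)%:E = lam a l else True)
  | CDeriv a b => d a = x b
  end.

(* The distinguished times of a segment are [sg_time 0 < sg_time 1 < ...];
   [sg_pt i] is the state at [sg_time i], and [sg_iv i] the state on the open
   interval between [sg_time i] and [sg_time i.+1].  [sg_num] is [Some n] when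
   there are [n] such intervals, and [None] when there are infinitely many.
   [sg_val v] and [sg_der v] are the value and the derivative of [v] as
   functions of the local clock; [sg_linf] and [sg_dinf] are their values at
   time +oo, used only if the segment ends there. *)
Record segment := Segment {
  sg_region : nat;
  sg_num : option nat;
  sg_time : nat -> \bar R;
  sg_pt : nat -> state;
  sg_iv : nat -> state;
  sg_val : nat -> R -> R;
  sg_der : nat -> R -> R;
  sg_linf : nat -> R;
  sg_dinf : nat -> R }.

Definition sg_end (g : segment) : \bar R :=
  if sg_num g is Some n then sg_time g n else +oo%E.

Definition sg_dom (g : segment) : set R :=
  [set t | (0 <= t)%R /\ (t%:E <= sg_end g)%E].

Definition val_at (g : segment) (t : \bar R) (v : nat) : R :=
  if t is r%:E%E then sg_val g v r else sg_linf g v.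
Definition der_at (g : segment) (t : \bar R) (v : nat) : R :=
  if t is r%:E%E then sg_der g v r else sg_dinf g v.

(* Index [i] is at most [n], resp. less than [n], where [None] is infinity. *)
Definition le_opt (i : nat) (n : option nat) : bool :=
  if n is Some k then i <= k else true.
Definition lt_opt (i : nat) (n : option nat) : bool :=
  if n is Some k then i < k else true.

(* Derivatives at the ends of the domain are one-sided. *)
Definition smooth_on (D : set R) (f df : R -> R) : Prop :=
  (forall t, D t ->
     (fun s => (f s - f t) / (s - t))%R @ within D (dnbhs t) --> df t) /\
  {within D, continuous df}.

Definition timeline_ok M lam (g : segment) : Prop :=
  [/\ sg_time g 0 = 0%E,
      lt_opt 0 (sg_num g),
      (forall i, lt_opt i (sg_num g) -> (sg_time g i < sg_time g i.+1)%E),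
      (sg_num g = None ->
         forall B : R, exists i, (B%:E < sg_time g i)%E)
    & [/\ forall i, le_opt i (sg_num g) ->
            state_holds M lam (sg_pt g i)
              (val_at g (sg_time g i)) (der_at g (sg_time g i)),
          forall i (t : R), lt_opt i (sg_num g) ->
            (sg_time g i < t%:E)%E -> (t%:E < sg_time g i.+1)%E ->
            state_holds M lam (sg_iv g i) (val_at g t%:E) (der_at g t%:E)
        & forall i, lt_opt i.+1 (sg_num g) ->
            ~ (sg_iv g i = sg_pt g i.+1 /\ sg_pt g i.+1 = sg_iv g i.+1)]].

Definition segment_ok M lam (g : segment) : Prop :=
  [/\ sg_region g < size (m_regions M),
      timeline_ok M lam g,
      (forall v, v < nvars M ->
         smooth_on (sg_dom g) (sg_val g v) (sg_der g v) /\
         (sg_num g <> None -> sg_end g = +oo%E ->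
            sg_val g v t @[t --> +oo%R] --> sg_linf g v /\
            sg_der g v t @[t --> +oo%R] --> sg_dinf g v)),
      (forall c, List.In c (rg_constrs (region_of M (sg_region g))) ->
         corr_holds lam c /\
         forall t : R, sg_dom g t ->
           constr_holds lam c (val_at g t%:E) (der_at g t%:E))
    & (forall tr, List.In tr (rg_trans (region_of M (sg_region g))) ->
         forall t : R, (0 < t)%R -> (t%:E < sg_end g)%E ->
         ~ trigger_holds M lam (tr_trigger tr) (val_at g t%:E) (der_at g t%:E))].

(* Transition [tr] leads from the end of [g] to the start of [h]. *)
Definition takes_transition M lam (tr : transition) (g h : segment) : Prop :=
  let b := sg_end g in
  [/\ trigger_holds M lam (tr_trigger tr) (val_at g b) (der_at g b),
      sg_region h = tr_target tr,
      forall v, v \in tr_inh_mag tr -> val_at h 0%E v = val_at g b v,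
      forall v, v \in tr_inh_dir tr ->
        dir_of (der_at h 0%E v) = dir_of (der_at g b v)
    & forall a, a \in tr_assert tr ->
        qval_holds M lam a.1 a.2 (val_at h 0%E a.1) (der_at h 0%E a.1)].

Definition about_to_leave M lam (g : segment) v : Prop :=
  let b := sg_end g in
  let x := val_at g b v in
  let d := der_at g b v in
  qval_holds M lam v (At 0, Dec) x d \/
  qval_holds M lam v (At (size (qs_lms (qs_of M v))).-1, Inc) x d.

Definition last_segment_ok M lam (g : segment) : Prop :=
  sg_num g <> None ->
  (forall tr, List.In tr (rg_trans (region_of M (sg_region g))) ->
     ~ trigger_holds M lam (tr_trigger tr)
         (val_at g (sg_end g)) (der_at g (sg_end g))) /\
  (sg_end g = +oo%E \/ exists2 v, v < nvars M & about_to_leave M lam g v).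

(* [tj_last] is the index of the last segment, [None] if there are infinitely
   many segments. *)
Record trajectory := Trajectory {
  tj_lam : lm_assignment;
  tj_seg : nat -> segment;
  tj_last : option nat }.

Definition is_trajectory (I : qinput) (T : trajectory) : Prop :=
  let M := in_model I in
  let lam := tj_lam T in
  [/\ good_lms M lam,
      sg_region (tj_seg T 0) = in_region I /\ sg_pt (tj_seg T 0) 0 = in_state I,
      (forall k, le_opt k (tj_last T) -> segment_ok M lam (tj_seg T k)),
      (forall k, lt_opt k (tj_last T) ->
         sg_num (tj_seg T k) <> None /\
         exists2 tr,
           List.In tr (rg_trans (region_of M (sg_region (tj_seg T k))))
         & takes_transition M lam tr (tj_seg T k) (tj_seg T k.+1))
    & (forall k, tj_last T = Some k -> last_segment_ok M lam (tj_seg T k))].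

(* The first [m] entries of the behavior contributed by a segment. *)
Definition seg_items (g : segment) (m : nat) : behavior :=
  mkseq (fun i => (sg_region g, odd i,
                   if odd i then sg_iv g i./2 else sg_pt g i./2)) m.

(* A segment with [n] intervals contributes [2 n + 1] entries. *)
Definition seg_length (g : segment) : option nat :=
  omap (fun n => n.*2.+1) (sg_num g).

Definition seg_all_items (g : segment) : behavior :=
  seg_items g (odflt 0 (seg_length g)).

(* [l] is a nonempty finite prefix of the behavior of [T]. *)
Definition behavior_prefix (T : trajectory) (l : behavior) : Prop :=
  exists k m, [/\ le_opt k (tj_last T), 0 < m,
    le_opt m (seg_length (tj_seg T k))
  & l = flatten [seq seg_all_items (tj_seg T i) | i <- iota 0 k] ++
        seg_items (tj_seg T k) m].

Definition behavior_tree (I : qinput) : set behavior :=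
  [set l | exists2 T, is_trajectory I T & behavior_prefix T l].

Definition tree_root (I : qinput) : behavior :=
  [:: (in_region I, false, in_state I)].

Definition ancestor (l l' : behavior) : bool :=
  [&& l != [::], prefix l l' & l != l'].

(* The leaf of a branch of a finite tree is the behavior along that branch. *)
Definition branch (I : qinput) (l : behavior) : Prop :=
  behavior_tree I l /\ forall l', behavior_tree I l' -> ~~ ancestor l l'.

End Semantics.

(** * Algorithms

    Programs are those of the WHILE language of N. D. Jones (Computability and
    Complexity from a Programming Perspective, 1997), whose data are binary
    trees, with an output command added; it is Turing complete.  Registers are
    indexed by [nat]. *)

Inductive tree := Leaf | Node of tree & tree.

Inductive prog :=
| PLeaf of nat
| PNode of nat & nat & nat
| PLeft of nat & nat
| PRight of nat & nat
| PSeq of prog & prog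
| PWhile of nat & prog
| PPrint of nat.

(* The programs still to be executed, the contents of the registers, and the
   trees printed so far. *)
Definition config : Type := (seq prog * (nat -> tree) * seq tree)%type.

Definition upd (s : nat -> tree) x t : nat -> tree :=
  fun y => if y == x then t else s y.

Definition step (c : config) : config :=
  let: (todo, s, out) := c in
  if todo isn't p :: k then c else
  match p with
  | PLeaf x => (k, upd s x Leaf, out)
  | PNode x y z => (k, upd s x (Node (s y) (s z)), out)
  | PLeft x y => (k, upd s x (if s y is Node t _ then t else Leaf), out)
  | PRight x y => (k, upd s x (if s y is Node _ t then t else Leaf), out)
  | PSeq p1 p2 => (p1 :: p2 :: k, s, out)
  | PWhile x p1 => if s x is Node _ _ then (p1 :: todo, s, out) else (k, s, out)
  | PPrint x => (k, s, rcons out (s x))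
  end.

(* The configuration after [n] steps on the datum [t], given in register 0. *)
Definition run (A : prog) (t : tree) (n : nat) : config :=
  iter n step ([:: A], upd (fun=> Leaf) 0 t, [::]).

Definition halted (A : prog) (t : tree) (n : nat) : bool :=
  nilp (run A t n).1.1.

Definition output (A : prog) (t : tree) (n : nat) : seq tree :=
  (run A t n).2.

(** ** Representation of inputs and behaviors as trees *)

Definition enc_nat (n : nat) : tree := iter n (Node Leaf) Leaf.
Definition enc_bool (b : bool) : tree := enc_nat b.
Definition enc_pair S T (f : S -> tree) (g : T -> tree) (p : S * T) : tree :=
  Node (f p.1) (g p.2).
Definition enc_seq T (f : T -> tree) (s : seq T) : tree :=
  foldr (fun x => Node (f x)) Leaf s.
Definition enc_option T (f : T -> tree) (o : option T) : tree :=
  if o is Some x then Node Leaf (f x) else Leaf.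
Definition enc_tag (n : nat) (ts : seq tree) : tree :=
  Node (enc_nat n) (enc_seq id ts).

Definition enc_qspace (q : qspace) : tree :=
  enc_tag 0 [:: enc_seq (fun l => enc_nat (nat_of_landmark l)) (qs_lms q);
                enc_bool (qs_lo q); enc_bool (qs_hi q)].

Definition enc_mag (m : mag) : tree :=
  match m with
  | At i => enc_tag 0 [:: enc_nat i]
  | Between i => enc_tag 1 [:: enc_nat i]
  end.

Definition enc_qval : qval -> tree :=
  enc_pair enc_mag (fun d => enc_nat (nat_of_dir d)).

Definition enc_state : state -> tree := enc_seq enc_qval.

Definition enc_corr3 : nat * nat * nat -> tree :=
  enc_pair (enc_pair enc_nat enc_nat) enc_nat.

Definition enc_constr (c : constr) : tree :=
  match c with
  | CAdd x y z cs =>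
      enc_tag 0 [:: enc_nat x; enc_nat y; enc_nat z; enc_seq enc_corr3 cs]
  | CMult x y z cs =>
      enc_tag 1 [:: enc_nat x; enc_nat y; enc_nat z; enc_seq enc_corr3 cs]
  | CConst x o cs =>
      enc_tag 2 [:: enc_nat x; enc_option enc_nat o; enc_seq enc_nat cs]
  | CDeriv x y => enc_tag 3 [:: enc_nat x; enc_nat y]
  end.

Fixpoint enc_trigger (g : trigger) : tree :=
  match g with
  | TPrim v q => enc_tag 0 [:: enc_nat v; enc_qval q]
  | TNot g1 => enc_tag 1 [:: enc_trigger g1]
  | TAnd g1 g2 => enc_tag 2 [:: enc_trigger g1; enc_trigger g2]
  | TOr g1 g2 => enc_tag 3 [:: enc_trigger g1; enc_trigger g2]
  end.

Definition enc_transition (tr : transition) : tree :=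
  enc_tag 0 [:: enc_trigger (tr_trigger tr); enc_nat (tr_target tr);
                enc_seq enc_nat (tr_inh_mag tr); enc_seq enc_nat (tr_inh_dir tr);
                enc_seq (enc_pair enc_nat enc_qval) (tr_assert tr)].

Definition enc_region (r : region) : tree :=
  enc_tag 0 [:: enc_seq enc_constr (rg_constrs r);
                enc_seq enc_transition (rg_trans r)].

Definition enc_model (M : model) : tree :=
  enc_tag 0 [:: enc_seq enc_qspace (m_vars M); enc_seq enc_region (m_regions M)].

Definition enc_input (I : qinput) : tree :=
  enc_tag 0 [:: enc_model (in_model I); enc_nat (in_region I);
                enc_state (in_state I)].

Definition enc_behavior : behavior -> tree :=
  enc_seq (enc_pair (enc_pair enc_nat enc_bool) enc_state).

(* The report of inconsistency; a nonempty behavior is never encoded so. *)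
Definition inconsistent : tree := Leaf.

(** ** The output specification *)

Definition sound_complete_on (R : realType) (A : prog) (I : qinput) : Prop :=
  let tr := @behavior_tree R I in
  let e := enc_input I in
  [/\ tr = set0 ->
        exists2 n, halted A e n & output A e n = [:: inconsistent],
      tr !=set0 -> finite_set tr ->
        exists2 n, halted A e n &
          exists2 ls : seq behavior, output A e n = map enc_behavior ls &
            forall l, l \in ls <-> branch R I l
    & ~ finite_set tr ->
        (forall n, ~~ halted A e n) /\
        exists nodes : nat -> behavior,
          [/\ forall n, output A e n =
                map enc_behavior (mkseq nodes (size (output A e n))),
              forall i, exists n, i <= size (output A e n),
              forall l, tr l <-> exists i, nodes i = l,
              nodes 0 = tree_root I
            & forall i l, ancestor l (nodes i) -> exists2 j, j < i & nodes j = l]].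

(* Main.v *)
(** Diagonalization.  For a program [A] we build an input [I] whose model simulates
    [A] on (the encoding of) [I] itself and gets stuck, so that [I] has no
    trajectory, exactly when the first tree printed by [A] is a [Node].  If [A]
    reports inconsistency first, or never prints, the simulation runs forever and
    the behavior tree is infinite, so [A] should have printed the root, which is a
    [Node]; otherwise the tree is empty and [A] should have printed [Leaf].

    The simulation goes through counter machines.  A counter is a real variable
    holding a multiple of an unknown unit [u > 0]; counter [c] of the machine is
    kept constant in every region, and the assignment [z := x + y] takes place on
    entering a region with the constraint [X + Y = Z] in which all counters except
    [z] are inherited.  Derivative constraints not being available, time is driven
    by an unconstrained clock variable on [[0, oo)]: all transitions are triggered
    when the clock stops increasing.  A segment on which it increased forever
    would have a finite limit, hence a derivative tending to 0, and the trigger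
    would hold at time +oo; so every segment is left through a transition.

    Self-reference is Kleene's quine: [I] loads a datum [d] into the machine by a
    chain of regions and then runs the program [fill; A], where [fill] computes the
    encoding of [I] from [d].  The datum is a list of bits, a postfix description
    of a template containing the parts of the encoding that do not depend on [d]. *)

From HB Require Import structures.
From mathcomp Require Import all_boot all_order all_algebra.
From mathcomp Require Import boolp classical_sets cardinality reals ereal.
From mathcomp Require Import topology normedtype derive.
From mathcomp Require Import zify ring lra.
Require Import Defs.

Set Implicit Arguments.
Unset Strict Implicit.
Unset Printing Implicit Defensive.

Import Order.TTheory GRing.Theory Num.Theory.
Import numFieldNormedType.Exports.
Local Open Scope classical_set_scope.
Local Open Scope nat_scope.

(** * From WHILE programs to counter programs *)

Definition updn (v : nat -> nat) x a : nat -> nat :=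
  fun y => if y == x then a else v y.

Section Run.
Variables (C : Type) (next : C -> option C).

Definition orun n c : option C := iter n (obind next) (Some c).

Lemma orunD m n c : orun (m + n) c = obind (orun m) (orun n c).
Proof.
rewrite /orun iterD; case: (iter n _ _) => //=.
by elim: m => //= m ->.
Qed.

Lemma orun_None m n c : m <= n -> orun m c = None -> orun n c = None.
Proof. by move=> le_mn cm; rewrite -(subnK le_mn) orunD cm. Qed.

(** At least one step is required: each silent WHILE step then costs at least one counter step, so
    an endless silent run stays endless after compilation. *)
Definition reach c c' := exists n, orun n.+1 c = Some c'.

Lemma reach_trans c1 c2 c3 : reach c1 c2 -> reach c2 c3 -> reach c1 c3.
Proof.
by case=> m Hm [n Hn]; exists (n + m.+1); rewrite -addSn orunD Hm.
Qed.

Lemma reach_step c c' : next c = Some c' -> reach c c'.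
Proof. by exists 0. Qed.

Lemma reach_next c1 c2 c3 : next c1 = Some c2 -> reach c2 c3 -> reach c1 c3.
Proof. by move/reach_step; apply: reach_trans. Qed.

End Run.

Inductive cstmt :=
| SAdd of nat & nat & nat
| SSub of nat & nat & nat
| SSeq of cstmt & cstmt
| SWhile of nat & cstmt
| SPrint of nat.

HB.instance Definition _ := gen_eqMixin cstmt.

Definition scfg : Type := (seq cstmt * (nat -> nat))%type.

Definition sstep (c : scfg) : option scfg :=
  let: (todo, v) := c in
  if todo isn't p :: k then Some c else
  match p with
  | SAdd z x y => Some (k, updn v z (v x + v y))
  | SSub z x y => if v y <= v x then Some (k, updn v z (v x - v y)) else None
  | SSeq p1 p2 => Some (p1 :: p2 :: k, v)
  | SWhile x p1 => Some (if 0 < v x then p1 :: todo else k, v)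
  (* Printing [Leaf] loops forever, printing a [Node] is stuck. *)
  | SPrint x => if v x == 0 then Some c else None
  end.

Fixpoint block p ps :=
  if ps is q :: ps' then SSeq p (block q ps') else p.

(* With this pairing, prefixing a list of bits with [Leaf] or [Node Leaf Leaf] maps
   its code [r] to [2 r + 1] or [4 r + 2], so that a fixed list is loaded by
   additions only (see [kinds]). *)
Fixpoint code t :=
  if t is Node l r then 2 ^ code l * (code r).*2.+1 else 0.

(* Counter 0 holds 0, counter 1 holds the unit and counters 2 to 7 are scratch;
   register [x] of a WHILE program is kept, encoded by [code], in counter [reg x]. *)
Notation reg x := (x.+4.+4).

(* Divides counter 5 by 2 until it is odd, counting in counter 6.  Halving iterates
   [(g, h) -> (h + 1, g)] on counters 4 and 3: starting from [(0, 0)], [n] steps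
   lead to the upper and lower halves of [n]. *)
Definition split_loop := SWhile 5 (block (SAdd 2 5 0) [::
  SAdd 3 0 0; SAdd 4 0 0;
  SWhile 2 (block (SAdd 7 4 0) [:: SAdd 4 3 1; SAdd 3 7 0; SSub 7 2 1; SAdd 2 7 0]);
  SSub 2 4 3; SAdd 7 6 1; SAdd 6 7 0; SAdd 5 3 0;
  SWhile 2 (block (SAdd 5 0 0) [:: SSub 7 6 1; SAdd 6 7 0; SAdd 2 0 0])]).

Definition split_at y z :=
  block (SAdd 5 y 0) [:: SAdd 6 0 0; SAdd 3 0 0; split_loop; z].

Fixpoint comp (p : prog) : cstmt :=
  match p with
  | PLeaf x => SAdd (reg x) 0 0
  | PNode x y z =>
      block (SAdd 2 (reg z) (reg z)) [:: SAdd 3 2 1; SAdd 5 (reg y) 0;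
        SWhile 5 (block (SAdd 2 3 3) [:: SAdd 3 2 0; SSub 7 5 1; SAdd 5 7 0]);
        SAdd (reg x) 3 0]
  | PLeft x y => split_at (reg y) (SAdd (reg x) 6 0)
  | PRight x y => split_at (reg y) (SAdd (reg x) 3 0)
  | PSeq p1 p2 => SSeq (comp p1) (comp p2)
  | PWhile x p1 => SWhile (reg x) (comp p1)
  | PPrint x => SPrint (reg x)
  end.

Definition counters a b c d e f (r : nat -> nat) : nat -> nat := fun i =>
  match i with
  | 0 => 0 | 1 => 1 | 2 => a | 3 => b | 4 => c | 5 => d | 6 => e | 7 => f
  | reg x => r x
  end.

Lemma updn_counters a b c d e f r k :
  (updn (counters a b c d e f r) 2 k = counters k b c d e f r) *
  (updn (counters a b c d e f r) 3 k = counters a k c d e f r) *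
  (updn (counters a b c d e f r) 4 k = counters a b k d e f r) *
  (updn (counters a b c d e f r) 5 k = counters a b c k e f r) *
  (updn (counters a b c d e f r) 6 k = counters a b c d k f r) *
  (updn (counters a b c d e f r) 7 k = counters a b c d e k r) *
  (forall x, updn (counters a b c d e f r) (reg x) k = counters a b c d e f (updn r x k)).
Proof.
by do !split=> *; apply/funext; do 8!case=> //.
Qed.

Local Notation "c ~> c'" := (reach sstep c c') (at level 70).

Ltac sgo := apply: reach_next => /=; [reflexivity | rewrite ?updn_counters /=].

Lemma double_loop k a b c d e f r :
  exists a' f', (SWhile 5 (block (SAdd 2 3 3)
      [:: SAdd 3 2 0; SSub 7 5 1; SAdd 5 7 0]) :: k, counters a b c d e f r) ~>
    (k, counters a' (2 ^ d * b) c 0 e f' r).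
Proof.
elim: d a b f => [|d IH] a b f.
  by exists a, f; apply: reach_step; rewrite /= mul1n.
have [a' [f' IH']] := IH (b + b) (b + b + 0) d.
exists a', f'; do 8 sgo.
by move: IH'; rewrite subn1 !addn0 /= expnSr -mulnA mul2n -addnn.
Qed.

Lemma comp_node k x y z a b c d e f r :
  exists a' b' f', (comp (PNode x y z) :: k, counters a b c d e f r) ~>
    (k, counters a' b' c 0 e f' (updn r x (2 ^ r y * (r z).*2.+1))).
Proof.
have [a' [f' H]] := double_loop (SAdd (reg x) 3 0 :: k)
  (r z + r z) (r z + r z + 1) c (r y) e f r.
exists a', (2 ^ r y * (r z + r z + 1)), f'; do 7 sgo.
rewrite addn0; apply: reach_trans H _.
by apply: reach_step; rewrite /= updn_counters addn0 addnn addn1.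
Qed.

Lemma half_loop a b c d e f r :
  exists f', forall k, (SWhile 2 (block (SAdd 7 4 0)
      [:: SAdd 4 3 1; SAdd 3 7 0; SSub 7 2 1; SAdd 2 7 0]) :: k,
      counters a b c d e f r) ~>
    (k, counters 0 (if odd a then c + a./2 else b + a./2)
             (if odd a then b + a./2.+1 else c + a./2) d e f' r).
Proof.
elim: a b c f => [|a IH] b c f.
  by exists f => k; apply: reach_step; rewrite /= !addn0.
have [f' IH'] := IH c (b + 1) a.
exists f' => k; do 10 sgo.
move: {IH'}(IH' k); rewrite subn1 !addn0 /= uphalf_half.
case: (odd a) => /=; rewrite ?add0n ?add1n => H.
  by move: H; rewrite !addnS !addSn addn0.
by move: H; rewrite !addnS !addSn addn0.
Qed.

(** The parity of [n] is the difference of its two halves. For odd [n] the division is undone: the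
    increment of counter 6 is taken back and counter 5 is cleared, which ends the loop with [n./2]
    left in counter 3. *)
Lemma split_body k n a b c e f r :
  0 < n -> exists f', (split_loop :: k, counters a b c n e f r) ~>
    (split_loop :: k, counters 0 n./2 (uphalf n) (if odd n then 0 else n./2)
                         (if odd n then e else e.+1) f' r).
Proof.
move=> n_gt0; have [f' H] := half_loop n 0 0 n e f r.
exists (if odd n then e else e.+1).
apply: reach_next => /=; first by rewrite n_gt0.
do 7 sgo; rewrite addn0; apply: reach_trans (H _) _.
have -> : (if odd n then 0 + n./2 else 0 + n./2) = n./2 by case: ifP.
have -> : (if odd n then 0 + n./2.+1 else 0 + n./2) = uphalf n.
  by rewrite uphalf_half; case: ifP.
have le_half : n./2 <= uphalf n by rewrite uphalf_half leq_addl.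
rewrite /split_loop; set lp := SWhile 5 _.
sgo; apply: reach_next => /=; first by rewrite le_half.
rewrite updn_counters uphalf_half addnK.
do 6 sgo; rewrite !addn0 addn1; case: (odd n).
  by do 8 sgo; rewrite !addn0 subn1; apply: reach_step.
exact: reach_step.
Qed.

Lemma split_loop_correct k n l m a b c e f r :
  n = 2 ^ l * m.*2.+1 ->
  exists c' f', (split_loop :: k, counters a b c n e f r) ~>
    (k, counters 0 m c' 0 (e + l) f' r).
Proof.
elim: l n a b c e f => [|l IH] n a b c e f Dn.
  have [|f' H] := split_body k a b c e f r (n := n); first by rewrite Dn.
  exists (uphalf n), f'; apply: reach_trans H _.
  have odd_n : odd n by rewrite Dn mul1n /= odd_double.
  rewrite odd_n; apply: reach_step; rewrite /= addn0.
  by rewrite {1}Dn mul1n /= uphalf_double.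
have [|f' H] := split_body k a b c e f r (n := n).
  by rewrite Dn muln_gt0 expn_gt0.
have Dn2 : n = (2 ^ l * m.*2.+1).*2 by rewrite Dn expnS -mulnA mul2n.
have [c' [f'' H']] := IH _ 0 n./2 (uphalf n) e.+1 f' (erefl _).
exists c', f''; apply: reach_trans H _.
by rewrite addnS -addSn; move: H'; rewrite Dn2 odd_double /= doubleK.
Qed.

Definition tleft t := if t is Node l _ then l else Leaf.
Definition tright t := if t is Node _ r then r else Leaf.

(** A leaf has code 0: the loop is then not entered and both parts come out as 0, just as [PLeft]
    and [PRight] yield [Leaf] on [Leaf]. *)
Lemma split_at_correct k y z t a b c d e f r :
  r y = code t ->
  exists a' c' f',
    (split_at (reg y) z :: k, counters a b c d e f r) ~>
    (z :: k, counters a' (code (tright t)) c' 0 (code (tleft t)) f' r).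
Proof.
move=> Dy; case: t => [|t1 t2] in Dy *.
  exists a, c, f; do 7 sgo; rewrite Dy addn0.
  exact: reach_step.
have [c' [f' H]] := split_loop_correct (z :: k) a 0 c 0 f r Dy.
exists 0, c', f'; do 7 sgo; rewrite !addn0.
exact: H.
Qed.

(** * Simulation of WHILE runs by structured counter programs *)

Definition matches (c : config) (c' : scfg) :=
  c'.1 = map comp c.1.1 /\
  exists a b c1 d e f, c'.2 = counters a b c1 d e f (code \o c.1.2).

Lemma code_upd s x t : updn (code \o s) x (code t) = code \o upd s x t.
Proof. by apply/funext => y; rewrite /updn /upd /=; case: eqP. Qed.

Definition printing (c : config) := if c.1.1 is PPrint _ :: _ then true else false.

Lemma step_matches c c' :
  matches c c' -> ~~ printing c ->
  exists2 c'', c' ~> c'' & matches (step c) c''.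
Proof.
case: c => [[todo s] out]; case: c' => [todo' v'] [/= -> [a [b [c [d [e [f ->]]]]]]].
set v := counters _ _ _ _ _ _ _.
case: todo => [_|[x|x y z|x y|x y|p1 p2|x p1|x] k //= _].
- by exists ([::], v); [exact: reach_step | split=> //; do 6!eexists].
- exists (map comp k, counters a b c d e f (code \o upd s x Leaf)).
    by apply: reach_step; rewrite /= updn_counters -code_upd.
  by split=> //; do 6!eexists.
- have [a' [b' [f' H]]] := comp_node (map comp k) x y z a b c d e f (code \o s).
  exists (map comp k, counters a' b' c 0 e f' (code \o upd s x (Node (s y) (s z)))).
    by rewrite -code_upd.
  by split=> //; do 6!eexists.
- have [a' [c' [f' H]]] := split_at_correct (map comp k) (SAdd (reg x) 6 0)
    a b c d e f (erefl ((code \o s) y)).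
  exists (map comp k, counters a' (code (tright (s y))) c' 0 (code (tleft (s y))) f'
      (code \o upd s x (tleft (s y)))).
    by apply: reach_trans H _; apply: reach_step; rewrite /= updn_counters addn0 code_upd.
  by split=> //; do 6!eexists.
- have [a' [c' [f' H]]] := split_at_correct (map comp k) (SAdd (reg x) 3 0)
    a b c d e f (erefl ((code \o s) y)).
  exists (map comp k, counters a' (code (tright (s y))) c' 0 (code (tleft (s y))) f'
      (code \o upd s x (tright (s y)))).
    by apply: reach_trans H _; apply: reach_step; rewrite /= updn_counters addn0 code_upd.
  by split=> //; do 6!eexists.
- by eexists; [exact: reach_step | split=> //; do 6!eexists].
- exists (if 0 < code (s x) then (comp p1 :: comp (PWhile x p1) :: map comp k, v)
          else (map comp k, v)).
    by apply: reach_step => /=; case: ifP.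
  case: (s x) => [|t1 t2] /=; first by split=> //; do 6!eexists.
  by rewrite muln_gt0 expn_gt0 /=; split=> //; do 6!eexists.
Qed.

Definition first_node (out : seq tree) := if out is Node _ _ :: _ then true else false.

Lemma output_prefix A t m n :
  m <= n -> exists out, output A t n = output A t m ++ out.
Proof.
move=> /subnK <-; elim: (n - m) => [|k [out IH]]; first by exists [::]; rewrite cats0.
rewrite addSn /output /run iterS -/(run A t (k + m)).
move: IH; rewrite /output; case: (run A t (k + m)) => [[todo s] out'] /= ->.
have step_out p q : exists out0, (step (p, s, q)).2 = q ++ out0.
  case: p => [|[x|x y z|x y|x y|p1 p2|x p1|x] k'] /=;
    try by exists [::]; rewrite cats0.
    by case: (s x); exists [::]; rewrite cats0.
  by exists [:: s x]; rewrite cats1.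
have [out0 ->] := step_out todo ((run A t m).2 ++ out).
by rewrite -catA; eexists.
Qed.

Lemma run_silent A t n c0 :
  matches (run A t 0) c0 ->
  output A t n = [::] ->
  exists2 m, n <= m &
    exists2 c, orun sstep m c0 = Some c & matches (run A t n) c.
Proof.
move=> Mc0; elim: n => [|n IH] silent; first by exists 0 => //; exists c0.
have silent_n : output A t n = [::].
  have [out] := output_prefix A t (leqnSn n); rewrite silent.
  by case: (output A t n).
have [m le_nm [c Dc Mc]] := IH silent_n.
have [|c' [k Hk] Mc'] := step_matches Mc.
  move: silent silent_n; rewrite /output /run iterS -/(run A t n) /printing.
  by case: (run A t n) => [[[|[x|x y z|x y|x y|p1 p2|x p1|x] k] s] [|? ?]] //=.
exists (k.+1 + m); first by rewrite addSn ltnS (leq_trans le_nm) ?leq_addl.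
by exists c'; rewrite ?orunD ?Dc.
Qed.

Lemma silent_or_prints A t :
  (forall n, output A t n = [::]) \/
  exists n x k s, run A t n = (PPrint x :: k, s, [::]).
Proof.
have [ex|silent] := pselect (exists n, ~~ nilp (output A t n)); last first.
  by left=> n; apply/nilP/negPn/negP => Hn; apply: silent; exists n.
right; case: (ex_minnP ex) => -[|m]; first by [].
move=> Hm min_m; have Hm' : output A t m = [::].
  by apply/nilP/negPn/negP => /min_m; rewrite ltnn.
exists m; move: Hm Hm'; rewrite /output /run iterS -/(run A t m).
case: (run A t m) => [[[|[x|x y z|x y|x y|p1 p2|x p1|x] k] s] out] //= + Dout;
  rewrite Dout //; first by case: (s x).
by move=> _; exists x, k, s.
Qed.

(** Up to the first print the simulation never gets stuck, so the first printed tree decides: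
    [SPrint] repeats forever on [Leaf] and is stuck on a [Node]. Outputs grow only at the end, so
    this first tree never changes. *)
Lemma comp_stuck A t c0 :
  matches (run A t 0) c0 ->
  (exists n, orun sstep n c0 = None) <-> (exists n, first_node (output A t n)).
Proof.
move=> Mc0; have [silent|[n [x [k [s Drun]]]]] := silent_or_prints A t.
  split=> -[n]; last by rewrite silent.
  have [m le_nm [c Dc _]] := run_silent Mc0 (silent n).
  by move=> /(orun_None le_nm); rewrite Dc.
have [|m le_nm [c Dc Mc]] := @run_silent A t n _ Mc0; first by rewrite /output Drun.
have Dout : output A t n.+1 = [:: s x] by rewrite /output /run iterS -/(run A t n) Drun.
have Dcm : exists v, c = (SPrint (reg x) :: map comp k, v) /\ v (reg x) = code (s x).
  move: Mc; rewrite Drun; case: c {Dc} => [td v] [/= -> [a [b [c1 [d [e [f ->]]]]]]].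
  by eexists.
have [v [Dcv Dvx]] := Dcm; rewrite {c Mc Dcm}Dcv in Dc.
case Dsx: (s x) => [|t1 t2] in Dout Dvx.
  split=> -[i].
    have stay j : orun sstep (j + m) c0 = Some (SPrint (reg x) :: map comp k, v).
      rewrite orunD Dc /=; elim: j => //= j IH.
      by rewrite IH /= Dvx.
    by move=> /(orun_None (leq_addr m i)); rewrite stay.
  have [le_in|lt_ni] := leqP i n.+1.
    have [out] := output_prefix A t le_in; rewrite Dout.
    by case: (output A t i) => // -[|? ?].
  by have [out ->] := output_prefix A t (ltnW lt_ni); rewrite Dout.
split=> _; [exists n.+1 | exists m.+1]; first by rewrite Dout.
by rewrite -add1n orunD Dc /= /orun /= Dvx /= gtn_eqF // muln_gt0 expn_gt0.
Qed.

(** * Counter machines *)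

Lemma reach_None C (next : C -> option C) c c' :
  reach next c c' ->
  (exists n, orun next n c = None) <-> (exists n, orun next n c' = None).
Proof.
case=> k Hk; split=> -[n Hn].
  by exists n; have := orun_None (leq_addr k.+1 n) Hn; rewrite orunD Hk.
by exists (n + k.+1); rewrite orunD Hk.
Qed.

(** Flat code with explicit jump targets: each instruction is to become one operating region. *)
Inductive finstr :=
| FAdd of nat & nat & nat & nat
| FSub of nat & nat & nat & nat
| FTest of nat & nat & nat
| FZero of nat & nat.

Definition fcfg : Type := (nat * (nat -> nat))%type.

Definition fnth (F : seq finstr) pc := nth (FTest 0 0 0) F pc.

Definition fstep (F : seq finstr) (c : fcfg) : option fcfg :=
  let: (pc, v) := c in
  match fnth F pc with
  | FAdd z x y t => Some (t, updn v z (v x + v y))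
  | FSub z x y t => if v y <= v x then Some (t, updn v z (v x - v y)) else None
  | FTest x t u => Some (if 0 < v x then t else u, v)
  | FZero x t => if v x == 0 then Some (t, v) else None
  end.

(** The target of an assignment differs from its operands because the constraint realizing it
    relates the values of all three at the same instant. *)
Definition wf_finstr n s (i : finstr) :=
  match i with
  | FAdd z x y t | FSub z x y t =>
      [&& z < n, x < n, y < n, z != x, z != y & t < s]
  | FTest x t u => [&& x < n, t < s & u < s]
  | FZero x t => (x < n) && (t < s)
  end.

Definition wf_flat n F := all (wf_finstr n (size F)) F.

(* The finitely many todo lists that occur while [p] is run before [k]; their
   positions are the program counters of the flat code. *)
Fixpoint conts p k : seq (seq cstmt) :=
  (p :: k) :: match p with
              | SSeq p1 p2 => conts p1 (p2 :: k) ++ conts p2 k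
              | SWhile x p1 => conts p1 (p :: k)
              | _ => [::]
              end.

Definition todos p := rcons (conts p [::]) [::].

Definition flat_instr (L : seq (seq cstmt)) td : finstr :=
  let ix k := index k L in
  match td with
  | [::] => FTest 0 (ix td) (ix td)
  | SAdd z x y :: k => FAdd z x y (ix k)
  | SSub z x y :: k => FSub z x y (ix k)
  | SSeq p1 p2 :: k => FTest 0 (ix (p1 :: p2 :: k)) (ix (p1 :: p2 :: k))
  | SWhile x p :: k => FTest x (ix (p :: td)) (ix k)
  | SPrint x :: _ => FZero x (ix td)
  end.

Definition fcode p := map (flat_instr (todos p)) (todos p).

Definition succs (td : seq cstmt) : seq (seq cstmt) :=
  match td with
  | [::] => [:: td]
  | SAdd _ _ _ :: k | SSub _ _ _ :: k => [:: k]
  | SSeq p1 p2 :: k => [:: p1 :: p2 :: k]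
  | SWhile x p :: k => [:: p :: td; k]
  | SPrint x :: _ => [:: td]
  end.

Lemma conts_head p k : p :: k \in conts p k.
Proof. by case: p => *; rewrite inE eqxx. Qed.

(** Execution of [p] before [k] leaves the collection only by arriving at [k]; for a loop, the body
    is run before the loop itself. *)
Lemma conts_closed p k td :
  td \in conts p k -> {subset succs td <= k :: conts p k}.
Proof.
elim: p k td => [z x y|z x y|p1 IH1 p2 IH2|x p IH|x] k td /=;
  rewrite !inE ?mem_cat.
- by move=> /eqP-> t; rewrite !inE => ->.
- by move=> /eqP-> t; rewrite !inE => ->.
- case/or3P=> [/eqP->|td1|td2] t.
  + by rewrite !inE mem_cat => /eqP->; rewrite conts_head /= ?orbT.
  + move=> /(IH1 _ _ td1); rewrite !inE mem_cat => /predU1P[->|->].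
      by rewrite conts_head /= ?orbT.
    by rewrite /= ?orbT.
  + by move=> /(IH2 _ _ td2); rewrite !inE mem_cat => /predU1P[->|->];
      rewrite ?eqxx ?orbT.
- case/orP=> [/eqP->|td1] t.
    by rewrite !inE => /orP[]/eqP->; rewrite ?eqxx // conts_head /= ?orbT.
  by move=> /(IH _ _ td1); rewrite !inE => /predU1P[->|->]; rewrite ?eqxx ?orbT.
- by move=> /eqP-> t; rewrite !inE => ->; rewrite orbT.
Qed.

Lemma todos_closed p td :
  td \in todos p -> {subset succs td <= todos p}.
Proof.
rewrite mem_rcons inE => /predU1P[->|]; last first.
  by move=> td_in t /(conts_closed td_in); rewrite mem_rcons.
by move=> t; rewrite inE => /eqP->; rewrite mem_rcons inE eqxx.
Qed.

Lemma sstep_succs td v c : sstep (td, v) = Some c -> c.1 \in succs td.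
Proof.
case: td => [[<-]|[z x y|z x y|p1 p2|x p|x] k] /=; rewrite ?inE ?eqxx //.
- by case=> <-; rewrite eqxx.
- by case: ifP => // _ [<-]; rewrite eqxx.
- by case=> <-; rewrite eqxx.
- by case=> <-; case: ifP; rewrite eqxx ?orbT.
- by case: ifP => // _ [<-]; rewrite eqxx.
Qed.

Definition flat_cfg p (c : scfg) : fcfg := (index c.1 (todos p), c.2).

Lemma fnth_todos p ext td :
  td \in todos p ->
  fnth (fcode p ++ ext) (index td (todos p)) = flat_instr (todos p) td.
Proof.
move=> td_in; rewrite /fnth nth_cat size_map index_mem td_in.
by rewrite (nth_map [::]) ?index_mem // nth_index.
Qed.

Lemma fstep_flat p ext c :
  c.1 \in todos p ->
  fstep (fcode p ++ ext) (flat_cfg p c) = omap (flat_cfg p) (sstep c).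
Proof.
case: c => td v /= td_in; rewrite /fstep /flat_cfg /= fnth_todos //.
by case: td td_in => [|[z x y|z x y|p1 p2|x q|x] k] td_in //=; case: ifP.
Qed.

Lemma orun_flat p ext n c :
  c.1 \in todos p ->
  orun (fstep (fcode p ++ ext)) n (flat_cfg p c) =
    omap (flat_cfg p) (orun sstep n c).
Proof.
(* Membership in [todos p] is carried along, since [index] identifies a list only there. *)
move=> c_in; suff [//] : orun (fstep (fcode p ++ ext)) n (flat_cfg p c) =
    omap (flat_cfg p) (orun sstep n c) /\
    forall c', orun sstep n c = Some c' -> c'.1 \in todos p.
elim: n => [|n [IH1 IH2]]; first by split=> // c' [<-].
rewrite /orun !iterS -!/(orun _ _ _) IH1.
case Dc: (orun sstep n c) => [[td v]|] //=; have td_in := IH2 _ Dc.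
split=> [|c' /sstep_succs c'_in]; first exact: (@fstep_flat p ext (td, v) td_in).
exact: todos_closed c'_in.
Qed.

Lemma flat_None p ext v :
  (exists n, orun (fstep (fcode p ++ ext)) n (0, v) = None) <->
  (exists n, orun sstep n ([:: p], v) = None).
Proof.
have p_in : ([:: p], v).1 \in todos p by rewrite mem_rcons inE conts_head orbT.
have D0 : flat_cfg p ([:: p], v) = (0, v).
  by rewrite /flat_cfg /= /todos; case: (p) => *; rewrite /= eqxx.
split=> -[n Hn]; exists n; move: Hn; rewrite -D0 orun_flat //.
  by case: orun.
by move=> ->.
Qed.

Fixpoint wf_cstmt n p :=
  match p with
  | SAdd z x y | SSub z x y => [&& z < n, x < n, y < n, z != x & z != y]
  | SSeq p1 p2 => wf_cstmt n p1 && wf_cstmt n p2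
  | SWhile x p1 => (x < n) && wf_cstmt n p1
  | SPrint x => x < n
  end.

Fixpoint regbound p :=
  match p with
  | PLeaf x | PPrint x => x.+1
  | PNode x y z => maxn x.+1 (maxn y.+1 z.+1)
  | PLeft x y | PRight x y => maxn x.+1 y.+1
  | PSeq p1 p2 => maxn (regbound p1) (regbound p2)
  | PWhile x p1 => maxn x.+1 (regbound p1)
  end.

(** Register [x] lives in counter [x + 8], whence the 8. Compiled code routes values through scratch
    counters, so no assignment reads its own target. *)
Lemma wf_comp n p : regbound p + 8 <= n -> wf_cstmt n (comp p).
Proof.
elim: p n => [x|x y z|x y|x y|p1 IH1 p2 IH2|x p IH|x] n /= le_n;
  rewrite ?IH1 ?IH2 ?IH; lia.
Qed.

Lemma conts_wf n p k td :
  wf_cstmt n p -> all (wf_cstmt n) k -> td \in conts p k -> all (wf_cstmt n) td.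
Proof.
elim: p k td => [z x y|z x y|p1 IH1 p2 IH2|x p IH|x] k td /= wfp wfk; rewrite !inE.
- by move=> /eqP->; rewrite /= wfp.
- by move=> /eqP->; rewrite /= wfp.
- have [wf1 wf2] := andP wfp; rewrite mem_cat => /or3P[/eqP->||].
  + by rewrite /= wfp.
  + by apply: IH1 => //=; rewrite wf2.
  + exact: IH2.
- have [wfx wf1] := andP wfp; case/orP=> [/eqP->|]; first by rewrite /= wfp.
  by apply: IH => //=; rewrite wfp.
- by move=> /eqP->; rewrite /= wfp.
Qed.

Lemma wf_flat_instr n p td :
  0 < n -> wf_cstmt n p -> td \in todos p ->
  wf_finstr n (size (todos p)) (flat_instr (todos p) td).
Proof.
move=> n_gt0 wfp td_in; have wf_td : all (wf_cstmt n) td.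
  move: td_in; rewrite mem_rcons inE => /predU1P[->//|].
  exact: conts_wf.
have Hs t : t \in succs td -> index t (todos p) < size (todos p).
  by rewrite index_mem; apply: todos_closed.
case: td td_in wf_td Hs => [|[z x y|z x y|p1 p2|x q|x] k] td_in //= wf_td Hs;
  rewrite ?n_gt0 ?Hs ?inE ?eqxx ?orbT //=.
- by case/andP: wf_td => /and5P[-> -> -> -> ->].
- by case/andP: wf_td => /and5P[-> -> -> -> ->].
- by case/andP: wf_td => /andP[-> _].
- by case/andP: wf_td => ->.
Qed.

(** * Preloading a list of bits into register 0 *)

Fixpoint chain m (ks : seq (nat * nat * nat)) : seq finstr :=
  if ks is (z, x, y) :: ks' then FAdd z x y m.+1 :: chain m.+1 ks'
  else [:: FAdd 2 8 8 0].

(* The triple [(z, x, y)] stands for [z := x + y].  Counter 8, i.e. register 0, is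
   multiplied by 2 and incremented for each bit, starting with the last one, and
   then doubled if the bit is [true]. *)
Fixpoint kinds (bs : seq bool) : seq (nat * nat * nat) :=
  if bs is b :: bs' then
    kinds bs' ++ [:: (2, 8, 8); (8, 2, 1)] ++
    (if b then [:: (2, 8, 0); (8, 2, 2)] else [::])
  else [::].

Definition fprog p bs := fcode p ++ chain (size (fcode p)) (kinds bs).

Lemma size_chain m ks : size (chain m ks) = (size ks).+1.
Proof. by elim: ks m => //= -[[z x] y] ks IH m /=; rewrite IH. Qed.

Lemma wf_fcode n p : 0 < n -> wf_cstmt n p -> wf_flat n (fcode p).
Proof.
move=> n_gt0 wfp; rewrite /wf_flat all_map size_map.
by apply/allP => td; apply: wf_flat_instr.
Qed.

Lemma wf_finstr_leq n s s' i : s <= s' -> wf_finstr n s i -> wf_finstr n s' i.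
Proof. by case: i => /= *; lia. Qed.

Lemma wf_fprog n p bs :
  8 < n -> wf_cstmt n p -> wf_flat n (fprog p bs).
Proof.
move=> n_gt8 wfp; rewrite /wf_flat all_cat; apply/andP; split.
  have := wf_fcode (ltn_trans (isT : 0 < 8) n_gt8) wfp; apply: sub_all => i.
  by apply: wf_finstr_leq; rewrite size_cat leq_addr.
have wf_kinds : all (fun k : nat * nat * nat =>
    [&& k.1.1 < n, k.1.2 < n, k.2 < n, k.1.1 != k.1.2 & k.1.1 != k.2]) (kinds bs).
  elim: bs => //= b bs IH; rewrite all_cat IH /=; case: b => /=; lia.
rewrite size_cat size_chain; move: (kinds bs) wf_kinds (size (fcode p)) => ks.
elim: ks => [|[[z x] y] ks IH] /= wfk m; first by rewrite andbT; lia.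
case/andP: wfk => wfk /IH/(_ m.+1); rewrite addSnnS => ->.
by rewrite andbT; lia.
Qed.

Definition exec (v : nat -> nat) (k : nat * nat * nat) :=
  updn v k.1.1 (v k.1.2 + v k.2).

(** The closing instruction of the chain acts as a jump to address 0, where the compiled program
    starts; it overwrites only scratch counter 2. *)
Lemma chain_run F m ks v :
  drop m F = chain m ks ->
  reach (fstep F) (m, v)
    (0, updn (foldl exec v ks) 2 (foldl exec v ks 8 + foldl exec v ks 8)).
Proof.
elim: ks m v => [|[[z x] y] ks IH] m v Dm.
  have DF : fnth F m = FAdd 2 8 8 0 by rewrite /fnth -[m]addn0 -nth_drop Dm.
  by apply: reach_step; rewrite /fstep DF.
have DF : fnth F m = FAdd z x y m.+1 by rewrite /fnth -[m]addn0 -nth_drop Dm addn0.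
apply: reach_next; first by rewrite /fstep DF.
by apply: IH; rewrite -[m.+1]add1n -drop_drop Dm /= drop0.
Qed.

Lemma kinds_run bs a b c d e f r :
  r 0 = 0 ->
  exists a', foldl exec (counters a b c d e f r) (kinds bs) =
    counters a' b c d e f (updn r 0 (code (enc_seq enc_bool bs))).
Proof.
move=> r0; elim: bs => [|bit bs [a' IH]] /=.
  by exists a; congr counters; apply/funext => -[|x] //=.
rewrite !foldl_cat IH; case: bit => /=; rewrite /exec /= !updn_counters /=.
  eexists; congr counters; apply/funext => -[|x] //=; rewrite /updn /=; lia.
eexists; congr counters; apply/funext => -[|x] //=; rewrite /updn /=; lia.
Qed.

Definition init_val := counters 0 0 0 0 0 0 (fun=> 0).

(** The preload takes finitely many steps and enters the compiled program with the datum in register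
    0, so [comp_stuck] applies. *)
Lemma fprog_stuck A bs :
  let F := fprog (comp A) bs in
  (exists n, orun (fstep F) n (size (fcode (comp A)), init_val) = None) <->
  (exists n, first_node (output A (enc_seq enc_bool bs) n)).
Proof.
set t := enc_seq _ _ => F.
have [a Dv] := kinds_run bs 0 0 0 0 0 0 (erefl ((fun=> 0) 0)).
have H : drop (size (fcode (comp A))) F =
  chain (size (fcode (comp A))) (kinds bs) by rewrite drop_size_cat.
apply: iff_trans (reach_None (chain_run init_val H)) _.
rewrite Dv updn_counters; apply: iff_trans (flat_None _ _ _) _.
apply: comp_stuck; split=> //=; do 6!eexists; congr counters.
by rewrite /= -code_upd.
Qed.

(** * Smooth functions on an interval *)

Section Smooth.
Variable R : realType.
Local Open Scope ring_scope.

Lemma smooth_eps (D : set R) (f df : R -> R) t e :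
  smooth_on D f df -> D t -> 0 < e -> exists2 r, 0 < r &
    forall s, D s -> s != t -> `|s - t| < r ->
      `|df t - (f s - f t) / (s - t)| < e.
Proof.
move=> [quot _] Dt e_gt0; have /cvgrPdist_lt/(_ e e_gt0) := quot t Dt.
rewrite near_withinE /dnbhs near_withinE => /nbhs_ballP[r /= r_gt0 Hr].
exists r => // s Ds s_neq st; apply: Hr => //=.
by rewrite /ball /= distrC.
Qed.

(** At interior points the derivative relative to [D] is the ordinary one, and bounded difference
    quotients give continuity up to both ends. *)
Lemma smooth_MVT (D : set R) (f df : R -> R) a b :
  smooth_on D f df -> `[a, b]%classic `<=` D -> a < b ->
  exists c, [/\ a < c, c < b & f b - f a = df c * (b - a)].
Proof.
move=> smf sub_abD lt_ab.
suff [c] : exists2 c, c \in `]a, b[ & f b - f a = df c * (b - a).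
  by rewrite in_itv /= => /andP[ac cb] ?; exists c.
apply: MVT => // [x|].
  rewrite in_itv /= => /andP[ax xb].
  have Dx : D x by apply: sub_abD; rewrite /= in_itv /= !ltW.
  suff lim : (fun h : R => h^-1 *: (f (h *: 1 + x) - f x)) @ dnbhs (0 : R) --> df x.
    by apply: DeriveDef; [apply/cvg_ex; exists (df x) | exact: cvg_lim].
  apply/cvgrPdist_lt => e e_gt0.
  have [r r_gt0 Hr] := smooth_eps smf Dx e_gt0.
  rewrite /dnbhs near_withinE; apply/nbhs_ballP.
  (* This radius keeps the shifted point inside [[a, b]], hence in [D]. *)
  exists (Num.min r (Num.min (x - a) (b - x))) => /=.
    by rewrite !lt_min r_gt0 !subr_gt0 ax xb.
  move=> h; rewrite /ball /= sub0r normrN !lt_min => /and3P[hr ha hb] h0.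
  have := Hr (h *: 1 + x); rewrite /GRing.scale /= mulr1 addrK mulrC; apply => //.
    apply: sub_abD; rewrite /= in_itv /=.
    by move: ha hb; rewrite !ltr_norml => /andP[? ?] /andP[? ?]; lra.
  by rewrite -subr_eq0 addrK.
apply/subspace_continuousP => x abx; have Dx := sub_abD _ abx.
(* Difference quotients near [x] are within 1 of [df x], so [|f s - f x|] is at most
   [(|df x| + 1) * |s - x|] there. *)
have [r r_gt0 Hr] := smooth_eps smf Dx (@ltr01 R).
apply/cvgrPdist_lt => e e_gt0; rewrite near_withinE; apply/nbhs_ballP.
have K_gt0 : 0 < `|df x| + 1 by rewrite ltr_wpDl.
exists (Num.min r (e / (`|df x| + 1))) => /=; first by rewrite lt_min r_gt0 divr_gt0.
move=> s; rewrite /ball /= lt_min distrC => /andP[sr se] abs.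
have [->|s_neq] := eqVneq s x; first by rewrite subrr normr0.
have := Hr _ (sub_abD _ abs) s_neq sr.
rewrite distrC => /(le_lt_trans (lerB_dist _ _)); rewrite ltrBlDl => Hq.
have sx_gt0 : 0 < `|s - x| by rewrite normr_gt0 subr_eq0.
rewrite -(@ltr_pM2r _ `|s - x|^-1) ?invr_gt0 // -normfV distrC -normrM.
apply: lt_trans Hq _; rewrite normfV ltr_pdivlMr //.
by move: se; rewrite ltr_pdivlMr // mulrC.
Qed.

Lemma smooth_const (D : set R) (f df : R -> R) a b :
  smooth_on D f df -> `[a, b]%classic `<=` D -> a <= b ->
  (forall t, D t -> df t = 0) -> f b = f a.
Proof.
move=> smf sub_abD; rewrite le_eqVlt => /predU1P[->//|lt_ab] df0.
have [c [ac cb]] := smooth_MVT smf sub_abD lt_ab.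
rewrite df0 ?mul0r; last by apply: sub_abD; rewrite /= in_itv /= !ltW.
by move/eqP; rewrite subr_eq0 => /eqP.
Qed.

(** Rules out a clock that still increases at time +oo. *)
Lemma no_positive_slope (f df : R -> R) (l dl : R) :
  smooth_on [set t | 0 <= t] f df ->
  f t @[t --> +oo%R] --> l -> df t @[t --> +oo%R] --> dl -> dl <= 0.
Proof.
move=> smf /cvgrPdist_lt/(_ 1 ltr01) fl /cvgrPdist_lt dfl.
rewrite leNgt; apply/negP => dl_gt0.
have dl2_gt0 : 0 < dl / 2 by rewrite divr_gt0.
have {}dfl := dfl (dl / 2) dl2_gt0.
have [A [_ HA]] : \forall t \near +oo, `|l - f t| < 1 /\ `|dl - df t| < dl / 2.
  by near=> t; split; near: t.
pose a := Num.max 0 A + 1.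
have [a_gt0 aA] : 0 < a /\ A < a.
  have m0 : 0 <= Num.max 0 A by rewrite le_max lexx.
  have mA : A <= Num.max 0 A by rewrite le_max lexx orbT.
  by rewrite /a; split; lra.
(* A slope above [dl / 2] over this length gains more than 2, whereas two values within 1 of [l]
   differ by less than 2. *)
pose b := a + 4 / dl.
have ab : a < b by rewrite ltrDl divr_gt0.
have sub_ab : `[a, b]%classic `<=` [set t : R | 0 <= t].
  by move=> t; rewrite /= in_itv /= => /andP[at_ _]; apply: le_trans at_; apply: ltW.
have [c [ac cb Dfb]] := smooth_MVT smf sub_ab ab.
have [fa _] := HA _ aA.
have [fb _] := HA _ (lt_trans aA ab).
have [_ dfc] := HA _ (lt_trans aA ac).
have Db : (dl / 2) * (b - a) = 2 by rewrite /b; field; rewrite gt_eqF.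
have dc : dl / 2 < df c by move: dfc; rewrite ltr_norml => /andP[_]; lra.
have : 2 < f b - f a by rewrite Dfb -Db ltr_pM2r ?subr_gt0.
by move: fa fb; rewrite !ltr_norml => /andP[? ?] /andP[? ?]; lra.
Unshelve. all: by end_near.
Qed.

Lemma pinfty_lim_const (f : R -> R) (c l : R) :
  (forall t, 0 < t -> f t = c) -> f t @[t --> +oo%R] --> l -> l = c.
Proof.
move=> fc fl; apply: (norm_cvg_unique fl); apply: cvg_near_cst.
by exists 0; split=> // t t0; apply: fc.
Qed.
End Smooth.

(** * The model of a counter machine *)

(** The only magnitudes are zero and positive, so a qualitative state tells which counters vanish
    but not their values. *)
Definition half_line := QSpace [:: LZero; LPlusInf] true false.

(* Variable 0 is the clock and variable [i.+1] is counter [i]. *)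
Definition dest i :=
  match i with FAdd z _ _ _ | FSub z _ _ _ => Some z | _ => None end.

(** The counter assigned in the target region [t] is left to the constraint of that region. The
    clock, variable 0, is never inherited and can restart. *)
Definition inherited n F t := [seq i.+1 | i <- iota 0 n & Some i != dest (fnth F t)].

Definition stop := TNot (TPrim 0 (Between 0, Inc)).

Definition ftransition n F g t := Transition g t (inherited n F t) [::] [::].

Definition ftransitions n F i :=
  match i with
  | FAdd _ _ _ t | FSub _ _ _ t | FZero _ t => [:: ftransition n F stop t]
  | FTest x t u =>
      [:: ftransition n F (TAnd stop (TPrim x.+1 (Between 0, Std))) t;
          ftransition n F (TAnd stop (TPrim x.+1 (At 0, Std))) u]
  end.

(** Subtraction is addition read backwards; since counters are nonnegative, the constraint is
    unsatisfiable exactly when the machine is stuck on it. *)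
Definition fconstr i :=
  match i with
  | FAdd z x y _ => [:: CAdd x.+1 y.+1 z.+1 [::]]
  | FSub z x y _ => [:: CAdd z.+1 y.+1 x.+1 [::]]
  | FTest _ _ _ => [::]
  | FZero x _ => [:: CConst x.+1 (Some 0) [::]]
  end.

Definition fregion n F i :=
  Region (fconstr i ++ [seq CConst j.+1 None [::] | j <- iota 0 n])
         (ftransitions n F i).

Definition fmodel n F := Model (nseq n.+1 half_line) (map (fregion n F) F).

Definition fstate n d (v : nat -> nat) : state :=
  (Between 0, d) :: mkseq (fun i => (if v i == 0 then At 0 else Between 0, Std)) n.

Definition finput n F m := QInput (fmodel n F) m (fstate n Inc init_val).

Lemma wf_fregion n F i :
  wf_finstr n (size F) i ->
  all (wf_constr (fmodel n F)) (rg_constrs (fregion n F i)) &&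
  all (wf_transition (fmodel n F)) (rg_trans (fregion n F i)).
Proof.
have nv : nvars (fmodel n F) = n.+1 by rewrite /nvars size_nseq.
have inh t : all (fun v => v < n.+1) (inherited n F t).
  by rewrite all_map; apply/allP => j; rewrite mem_filter mem_iota /= => /andP[_].
have wfa v d m : v < n.+1 -> wf_mag half_line m -> wf_assign (fmodel n F) (v, (m, d)).
  by move=> vn; rewrite /wf_assign nv vn /= /qs_of nth_nseq vn.
have wfs : wf_trigger (fmodel n F) stop by rewrite /= wfa.
have wft g t : wf_trigger (fmodel n F) g -> t < size F ->
    wf_transition (fmodel n F) (ftransition n F g t).
  by move=> wfg ts; rewrite /wf_transition wfg /= size_map ts nv inh.
move=> wfi; apply/andP; split.
  rewrite all_cat; apply/andP; split; last first.
    by rewrite all_map; apply/allP => j; rewrite mem_iota /= nv add0n ltnS => ->.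
  case: i wfi => [z x y t|z x y t|x t u|x t] //=; rewrite nv !ltnS.
  - by case/and5P=> -> -> ->.
  - by case/and5P=> -> -> ->.
  - by case/andP=> xn _; rewrite /is_lm /qs_of nth_nseq ltnS xn.
case: i wfi => [z x y t|z x y t|x t u|x t] /=; rewrite ?andbT.
- by case/and5P=> _ _ _ _ /andP[_ ts]; apply: wft.
- by case/and5P=> _ _ _ _ /andP[_ ts]; apply: wft.
- by case/and3P=> xn ts us; rewrite !wft //= !wfa.
- by case/andP=> _ ts; apply: wft.
Qed.

Lemma wf_finput n F m : wf_flat n F -> m < size F -> wf_input (finput n F m).
Proof.
move=> wfF mF; rewrite /wf_input /= size_map mF /=.
have nv : nvars (fmodel n F) = n.+1 by rewrite /nvars size_nseq.
apply/andP; split; last first.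
  rewrite /wf_state nv /= size_mkseq eqxx /=.
  apply/allP => -[|v]; rewrite mem_iota // => vn; have {}vn : v < n by lia.
  rewrite /qs_of /= nth_nseq vn nth_mkseq //=.
  by case: ifP.
rewrite /wf_model; apply/andP; split; first by rewrite all_nseq orbT.
by rewrite all_map; apply: sub_all wfF => i; apply: wf_fregion.
Qed.

Lemma add_const_fmodel n F : add_const_only (fmodel n F).
Proof.
rewrite /add_const_only all_map; apply/allT => i /=.
rewrite all_cat all_map; apply/andP; split; first by case: i.
exact/allT.
Qed.

Lemma In_cat T (x : T) s1 s2 : List.In x (s1 ++ s2) <-> List.In x s1 \/ List.In x s2.
Proof. by elim: s1 => [|y s1 IH] /=; [split=> [|[]]; auto | tauto]. Qed.

Lemma In_map (T : eqType) U (f : T -> U) s y :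
  List.In y (map f s) <-> exists2 x, x \in s & y = f x.
Proof.
elim: s => [|x s IH] /=; first by split=> // -[].
split=> [[<-|/IH[z zs ->]]|[z]].
- by exists x => //; rewrite inE eqxx.
- by exists z => //; rewrite inE zs orbT.
- rewrite inE => /predU1P[->|zs] Dy; first by left.
  by right; apply/IH; exists z.
Qed.

(** * Every trajectory follows the machine *)

Section Model.
Variables (R : realType) (n : nat) (F : seq finstr).
Hypothesis wfF : wf_flat n F.
Let M := fmodel n F.

Let nvE : nvars M = n.+1. Proof. by rewrite /nvars size_nseq. Qed.

Lemma qsE v : v <= n -> qs_of M v = half_line.
Proof. by move=> vn; rewrite /qs_of nth_nseq ltnS vn. Qed.

Lemma region_fmodel pc : pc < size F -> region_of M pc = fregion n F (fnth F pc).
Proof. by move=> pcF; rewrite /region_of (nth_map (FTest 0 0 0)). Qed.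

Lemma wf_fnth pc : pc < size F -> wf_finstr n (size F) (fnth F pc).
Proof. by move=> pcF; apply: (all_nthP _ wfF). Qed.

Lemma dir_of0 : dir_of (0 : R) = Std. Proof. by rewrite /dir_of ltxx. Qed.

Lemma dir_of_Inc (d : R) : dir_of d = Inc -> (0 < d)%R.
Proof. by rewrite /dir_of; case: ifP => //; case: ifP. Qed.

Section Lam.
Variable lam : lm_assignment R.
Hypothesis lamP : good_lms M lam.

Lemma lam_half v : v <= n -> lam v 0 = 0%E /\ lam v 1 = +oo%E.
Proof.
move=> vn; have [|den _] := lamP (v := v); first by rewrite nvE.
have lm i : i < 2 -> is_lm M v i by rewrite /is_lm qsE.
by have := den 0 (lm 0 isT); have := den 1 (lm 1 isT); rewrite qsE.
Qed.

(** The reachable part of [half_line] is the set of nonnegative reals, so value and derivative alone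
    determine the qualitative value. *)
Lemma qvalE v q (x d : R) : v <= n ->
  qval_holds M lam v q x d <->
  (0 <= x)%R /\ q = (if x == 0%R then At 0 else Between 0, dir_of d).
Proof.
move=> vn; have [l0 l1] := lam_half vn.
rewrite /qval_holds /wf_mag /mag_holds qsE //.
case: q => -[i|i] qd /=; split.
- case=> /and4P[]; case: i => [_ _ _ _|[|i]] //=; rewrite l0 => -[->] ->.
  by rewrite eqxx.
- by case=> x0; case: ifP => [/eqP-> [-> ->]|] //=; rewrite l0.
- case; rewrite ltnS ltnS leqn0 => /eqP-> /=; rewrite l0 l1 lte_fin => -[x0 _] ->.
  by rewrite ltW // gt_eqF.
- case=> x0; case: ifP => // /negbT xn0 [-> ->].
  by rewrite l0 l1 ltry lte_fin lt_neqAle eq_sym xn0.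
Qed.

Lemma running_gt0 (x d : R) :
  qval_holds M lam 0 (Between 0, Inc) x d <-> (0 < x)%R /\ (0 < d)%R.
Proof.
rewrite qvalE // lt_neqAle eq_sym; split.
  by case=> ->; case: eqP => // _ [/esym/dir_of_Inc].
by case=> /andP[/negPf-> ->] d0; rewrite /dir_of d0.
Qed.


Lemma counter_constr pc i : i < n ->
  List.In (CConst i.+1 None [::]) (rg_constrs (fregion n F (fnth F pc))).
Proof.
by move=> i_n; apply/In_cat; right; apply/In_map; exists i; rewrite // mem_iota.
Qed.

Section Segment.
Variable g : segment R.
Hypothesis gP : segment_ok M lam g.
Let pc := sg_region g.

Lemma region_lt : pc < size F.
Proof. by case: gP => rg _ _ _ _; move: rg; rewrite size_map. Qed.

Let regE : region_of M (sg_region g) = fregion n F (fnth F pc).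
Proof. exact: region_fmodel region_lt. Qed.

Lemma sg_end_gt0 : (0 < sg_end g)%E.
Proof.
case: gP => _ [t0 n_gt0 tlt _ _] _ _ _; rewrite /sg_end.
case: (sg_num g) n_gt0 tlt => [k|] /= k_gt0 tlt; last exact: ltry.
elim: k k_gt0 tlt => // -[|k] IH _ tlt; first by rewrite -t0 tlt.
by apply: lt_trans (IH isT _) (tlt _ _) => // i ik; apply: tlt; apply: ltn_trans ik _.
Qed.

Lemma dom0 : sg_dom g 0%R.
Proof. by split; rewrite ?lexx // ltW // sg_end_gt0. Qed.

Lemma dom_itv t : sg_dom g t -> `[0%R, t]%classic `<=` sg_dom g.
Proof.
move=> [t0 te] s; rewrite /= in_itv /= => /andP[s0 st]; split=> //.
by apply: le_trans te; rewrite lee_fin.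
Qed.

Lemma counter_const i t : i < n -> sg_dom g t ->
  sg_val g i.+1 t = sg_val g i.+1 0%R /\ sg_der g i.+1 t = 0%R.
Proof.
move=> i_n Dt; case: gP => _ _ sm cs _.
have der0 s : sg_dom g s -> sg_der g i.+1 s = 0%R.
  have [|_ H] := cs (CConst i.+1 None [::]); first by rewrite regE; apply: counter_constr.
  by move=> /H[].
have [|sm_i _] := sm i.+1; first by rewrite nvE.
split; last exact: der0.
by apply: (smooth_const sm_i (dom_itv Dt)) => //; case: Dt.
Qed.

(** If the segment ends at time +oo, the end values are limits of constant functions. *)
Lemma counter_end i : i < n -> sg_num g <> None ->
  val_at g (sg_end g) i.+1 = val_at g 0%E i.+1 /\
  der_at g (sg_end g) i.+1 = 0%R.
Proof.
move=> i_n num; case De: (sg_end g) sg_end_gt0 => [r||] //= e_gt0.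
  apply: counter_const => //; split; rewrite ?De //.
  by rewrite ltW // -lte_fin.
case: gP => _ _ sm _ _; have [|_ /(_ num De)[lv ld]] := sm i.+1; first by rewrite nvE.
have dom t : (0 <= t)%R -> sg_dom g t by split; rewrite ?De ?leey.
split.
  apply: pinfty_lim_const lv => t t0.
  by have [] := counter_const i_n (dom _ (ltW t0)).
apply: pinfty_lim_const ld => t t0.
by have [_] := counter_const i_n (dom _ (ltW t0)).
Qed.

Lemma start_state : state_holds M lam (sg_pt g 0) (val_at g 0%E) (der_at g 0%E).
Proof.
case: gP => _ [t0 _ _ _ [/(_ 0) + _ _]] _ _ _.
by rewrite t0; apply; case: sg_num.
Qed.

Lemma counter_ge0 i : i < n -> (0 <= val_at g 0%E i.+1)%R.
Proof.
move=> i_n; have [_ /(_ i.+1)] := start_state; rewrite nvE ltnS i_n => /(_ isT).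
by case/(qvalE _ _ _ i_n).
Qed.

(** In a test region the two transitions together cover a zero and a positive steady counter;
    elsewhere the stopped clock suffices. *)
Lemma trigger_complete (x d : nat -> R) :
  (forall i, i < n -> x i.+1 = val_at g 0%E i.+1 /\ d i.+1 = 0%R) ->
  ~ qval_holds M lam 0 (Between 0, Inc) (x 0) (d 0) ->
  exists2 tr, List.In tr (rg_trans (region_of M (sg_region g))) &
    trigger_holds M lam (tr_trigger tr) x d.
Proof.
move=> xd stopped; rewrite regE /=; have := wf_fnth region_lt; rewrite -/pc.
case: (fnth F pc) => [z y w t|z y w t|y t u|y t] /= wfi;
  try by eexists; [left; reflexivity | ].
have yn : y < n by case/and3P: wfi.
have [xy dy] := xd y yn; have y0 := counter_ge0 yn.
have [xy0|xyn0] := eqVneq (x y.+1) 0%R.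
  eexists; [by right; left | split=> //].
  by apply/(qvalE) => //; rewrite xy0 eqxx dy dir_of0.
eexists; [by left | split=> //].
by apply/(qvalE) => //; rewrite (negPf xyn0) dy dir_of0 xy.
Qed.

(* The clock is increasing, as otherwise a transition would be triggered. *)
Lemma running_inside t : (0 < t)%R -> (t%:E < sg_end g)%E ->
  qval_holds M lam 0 (Between 0, Inc) (val_at g t%:E 0) (der_at g t%:E 0).
Proof.
move=> t0 te; apply: contrapT => stopped.
have [i i_n|tr tr_in holds] := @trigger_complete (val_at g t%:E) (der_at g t%:E) _ stopped.
  by apply: counter_const => //; split; apply: ltW.
by case: gP => _ _ _ _ /(_ tr tr_in t t0 te).
Qed.

Lemma state_running (s : state) t : (0 < t)%R -> (t%:E < sg_end g)%E ->
  state_holds M lam s (val_at g t%:E) (der_at g t%:E) ->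
  s = (Between 0, Inc) ::
      mkseq (fun i => (if val_at g 0%E i.+1 == 0%R then At 0 else Between 0, Std)) n.
Proof.
move=> t0 te [ss sv]; apply: (@eq_from_nth _ (At 0, Std)).
  by rewrite /= size_mkseq ss nvE.
rewrite ss nvE => -[|i] i_n; have := sv _; rewrite nvE => /(_ _ i_n).
  move=> /(qvalE _ _ _ (leq0n _))[_ ->] /=.
  by have /(qvalE _ _ _ (leq0n _))[_ <-] := running_inside t0 te.
rewrite ltnS in i_n; move=> /(qvalE _ _ _ i_n)[_ ->] /=.
rewrite nth_mkseq //.
have [|-> ->] := counter_const (t := t) i_n; first by split; apply: ltW.
by rewrite dir_of0.
Qed.

(** Strictly inside a segment the clock increases and the counters are constant, so the state cannot
    change at [sg_time g 1] as infinitely many intervals would require. *)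
Lemma sg_num_finite : sg_num g <> None.
Proof.
move=> num; have e_inf : sg_end g = +oo%E by rewrite /sg_end num.
case: gP => _ [t0 _ tlt _ [pts ivs chg]] _ _ _.
rewrite num /= in tlt pts ivs chg.
have t01 := tlt 0 isT; rewrite t0 in t01; have t12 := tlt 1 isT.
have t23 := tlt 2 isT.
case D1: (sg_time g 1) t01 t12 => [a||] //= t01 t12; last by case: (sg_time g 2) t12.
case D2: (sg_time g 2) t12 t23 => [b||] //= t12 t23; last by case: (sg_time g 3) t23.
rewrite !lte_fin in t01 t12.
have inf r : (r%:E < sg_end g)%E by rewrite e_inf ltry.
have pt1 : state_holds M lam (sg_pt g 1) (val_at g a%:E) (der_at g a%:E).
  by rewrite -D1; apply: pts.
have iv0 : state_holds M lam (sg_iv g 0) (val_at g (a / 2)%:E) (der_at g (a / 2)%:E).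
  by apply: ivs => //; rewrite ?t0 ?D1 lte_fin; lra.
have iv1 : state_holds M lam (sg_iv g 1)
    (val_at g ((a + b) / 2)%:E) (der_at g ((a + b) / 2)%:E).
  by apply: ivs => //; rewrite ?D2 ?D1 lte_fin; lra.
apply: (chg 0 isT).
rewrite (state_running _ (inf _) pt1) // (state_running _ (inf _) iv0);
  rewrite ?(state_running _ (inf _) iv1) //; lra.
Qed.

(** Without a trigger at the end the clock still increases there. At time +oo this contradicts
    [no_positive_slope]. Otherwise some variable would be about to leave, but the clock is positive,
    the counters are steady and the last landmark is unreachable. *)
Lemma not_last : ~ last_segment_ok M lam g.
Proof.
move=> /(_ sg_num_finite)[no_trigger leaves].
have running : qval_holds M lam 0 (Between 0, Inc)
    (val_at g (sg_end g) 0) (der_at g (sg_end g) 0).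
  apply: contrapT => stopped.
  have [i i_n|tr tr_in] := @trigger_complete
    (val_at g (sg_end g)) (der_at g (sg_end g)) _ stopped.
    exact: counter_end i_n sg_num_finite.
  exact: no_trigger.
have [x0 d0] := (running_gt0 _ _).1 running.
case: leaves => [De|[v]].
  case: gP => _ _ sm _ _; have [|smc /(_ sg_num_finite De)[lv ld]] := sm 0.
    by rewrite nvE.
  have dom : sg_dom g = [set t | (0 <= t)%R].
    by apply/seteqP; split=> t; [case | split; rewrite ?De ?leey].
  rewrite dom in smc; have := no_positive_slope smc lv ld.
  by move: d0; rewrite De /=; lra.
rewrite nvE ltnS => vn; rewrite /about_to_leave qsE // => -[] /(qvalE _ _ _ vn)[_].
  case: v vn => [|v] vn.
    by rewrite gt_eqF.
  by have [_ ->] := counter_end vn sg_num_finite; rewrite dir_of0.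
by case: ifP.
Qed.

End Segment.

(** The hypothesis omits the counter assigned in this region; the constraint determines it, in the
    same unit [u]. Had the machine been stuck, a counter would be negative or a zero constraint
    violated. *)
Lemma simulation_step (g : segment R) (u : R) (v : nat -> nat) :
  segment_ok M lam g -> (0 < u)%R ->
  (forall i, i < n -> Some i != dest (fnth F (sg_region g)) ->
     val_at g 0%E i.+1 = (u * (v i)%:R)%R) ->
  exists t v', [/\ fstep F (sg_region g, v) = Some (t, v'),
    forall i, i < n -> val_at g 0%E i.+1 = (u * (v' i)%:R)%R &
    forall tr, List.In tr (rg_trans (region_of M (sg_region g))) ->
      trigger_holds M lam (tr_trigger tr)
        (val_at g (sg_end g)) (der_at g (sg_end g)) ->
      tr_target tr = t /\ tr_inh_mag tr = inherited n F t].
Proof.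
move=> gP u_gt0; have pcF := region_lt gP.
have val0 i : i < n -> (0 <= val_at g 0%E i.+1)%R := counter_ge0 gP (i := i).
have ends i := counter_end gP (i := i) ^~ (sg_num_finite gP).
case: (gP) => _ _ _ cs _; have := wf_fnth pcF.
have {}cs c : List.In c (fconstr (fnth F (sg_region g))) ->
    constr_holds lam c (val_at g 0%E) (der_at g 0%E).
  move=> c_in; have [|_ H] := cs c; last exact: H (dom0 gP).
  by rewrite region_fmodel //; apply/In_cat; left.
rewrite region_fmodel //; rewrite /fstep /= in cs *.
case: (fnth F _) cs => [z x y t|z x y t|x t t'|x t] cs /=.
- case/and5P=> zn xn yn zx /andP[zy _] Dv.
  have Dx : val_at g 0%E x.+1 = (u * (v x)%:R)%R.
    by apply: Dv => //; apply: contra zx => /eqP[->].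
  have Dy : val_at g 0%E y.+1 = (u * (v y)%:R)%R.
    by apply: Dv => //; apply: contra zy => /eqP[->].
  have := cs _ (or_introl erefl); rewrite /= in Dx Dy *; rewrite Dx Dy => Dz.
  exists t, (updn v z (v x + v y)); split=> // [i i_n|tr [<-|[]]] //.
  rewrite /updn; case: eqP => [->|/eqP iz]; first by rewrite -Dz natrD mulrDr.
  by rewrite Dv //; apply: contra iz => /eqP[->].
- case/and5P=> zn xn yn zx /andP[zy _] Dv.
  have Dx : val_at g 0%E x.+1 = (u * (v x)%:R)%R.
    by apply: Dv => //; apply: contra zx => /eqP[->].
  have Dy : val_at g 0%E y.+1 = (u * (v y)%:R)%R.
    by apply: Dv => //; apply: contra zy => /eqP[->].
  have := cs _ (or_introl erefl); rewrite /= in Dx Dy *; rewrite Dx Dy => Dz.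
  have yx : v y <= v x.
    have := val0 z zn; rewrite /= -(lerD2r (u * (v y)%:R)%R) Dz add0r.
    by rewrite ler_pM2l // ler_nat.
  exists t, (updn v z (v x - v y)); split=> [|i i_n|tr [<-|[]]] //; first by rewrite yx.
  rewrite /updn; case: eqP => [->|/eqP iz].
    by rewrite natrB // mulrBr -Dz addrK.
  by rewrite Dv //; apply: contra iz => /eqP[->].
- case/and3P=> xn _ _ Dv.
  have {}Dv i : i < n -> val_at g 0%E i.+1 = (u * (v i)%:R)%R.
    by move=> i_n; apply: Dv.
  exists (if 0 < v x then t else t'), v; split=> // tr.
  have Dx : (val_at g 0%E x.+1 == 0%R) = (v x == 0).
    by rewrite Dv // mulf_eq0 gt_eqF // pnatr_eq0.
  have [end_x end_dx] := ends x xn.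
  rewrite lt0n; case=> [<-|[<-|[]]] /= [_] /(qvalE _ _ _ xn)[_];
    by rewrite end_x Dx; case: eqP.
- case/andP=> xn _ Dv.
  have {}Dv i : i < n -> val_at g 0%E i.+1 = (u * (v i)%:R)%R.
    by move=> i_n; apply: Dv.
  have [_] := cs _ (or_introl erefl); have [-> _] := lam_half (v := x.+1) xn.
  move=> -[/eqP]; rewrite -[sg_val g _ _]/(val_at g 0%E x.+1) Dv //.
  rewrite mulf_eq0 gt_eqF //= pnatr_eq0 => x0.
  by exists t, v; rewrite x0; split=> // tr [<-|[]].
Qed.

Lemma simulation (m : nat) (T : trajectory R) k :
  is_trajectory (finput n F m) T -> tj_lam T = lam -> 1 < n ->
  exists u pc v, [/\ (0 < u)%R, orun (fstep F) k (m, init_val) = Some (pc, v),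
    le_opt k (tj_last T), sg_region (tj_seg T k) = pc &
    forall i, i < n -> Some i != dest (fnth F pc) ->
      val_at (tj_seg T k) 0%E i.+1 = (u * (v i)%:R)%R].
Proof.
move=> [_ [reg0 pt0] segs trs last] Dlam n_gt1; rewrite Dlam /= in segs trs last.
elim: k => [|k [u [pc [v [u_gt0 Dk le_k Dpc Dv]]]]].
  have le0 : le_opt 0 (tj_last T) by case: tj_last.
  have [_ st0] := start_state (segs 0 le0).
  have val0 i : i < n -> qval_holds M lam i.+1
      (if init_val i == 0 then At 0 else Between 0, Std)
      (val_at (tj_seg T 0) 0%E i.+1) (der_at (tj_seg T 0) 0%E i.+1).
    by move=> i_n; have := st0 i.+1; rewrite pt0 nvE ltnS /= nth_mkseq //; apply.
  (* The unit is the initial value of counter 1, i.e. of variable 2, which the initial state makes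
     positive. *)
  exists (val_at (tj_seg T 0) 0%E 2), m, init_val; split=> //.
    have /(qvalE _ _ _ n_gt1)[] := val0 1 n_gt1.
    by move=> x0 /= H; rewrite lt_def x0 andbT; move: H; case: eqP.
  move=> i i_n _; have /(qvalE _ _ _ i_n)[_] := val0 i i_n.
  by move: i {i_n} => [|[|[|[|[|[|[|[|i]]]]]]]] /=; rewrite ?mulr1 ?mulr0 //;
    case: eqP.
have lt_k : lt_opt k (tj_last T).
  case Dl: (tj_last T) le_k => [l|] //=; rewrite leq_eqVlt => /predU1P[Dkl|//].
  have segk : segment_ok M lam (tj_seg T k) by apply: segs; rewrite Dl Dkl /=.
  by case: (not_last segk); apply: last; rewrite Dl Dkl.
have segk := segs k le_k; rewrite -Dpc in Dv.
have [t [v' [Dstep Dv' Dtr]]] := simulation_step segk u_gt0 Dv.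
have [num [tr tr_in [tr_holds Dtgt inh_mag _ _]]] := trs k lt_k.
have [Dt Dinh] := Dtr tr tr_in tr_holds.
exists u, t, v'; split=> //.
- by rewrite /orun iterS -/(orun _ _ _) Dk /= -Dpc -Dstep.
- by rewrite Dtgt.
move=> i i_n i_dest; rewrite inh_mag; last first.
  by rewrite Dinh; apply/mapP; exists i; rewrite // mem_filter i_dest mem_iota.
by have [-> _] := counter_end segk i_n num; apply: Dv'.
Qed.

End Lam.
End Model.

Lemma tree_empty (R : realType) n F m :
  wf_flat n F -> 1 < n ->
  (exists k, orun (fstep F) k (m, init_val) = None) ->
  behavior_tree R (finput n F m) = set0.
Proof.
move=> wfF n_gt1 [k Dk]; apply/seteqP; split=> // l [T Tt _].
have lamP : good_lms (fmodel n F) (tj_lam T) by case: Tt.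
have [u [pc [v [_]]]] := simulation wfF lamP k Tt erefl n_gt1.
by rewrite Dk.
Qed.

(** * A trajectory for a machine that runs forever *)

Section InfiniteTree.
Variables (R : realType) (n : nat) (F : seq finstr) (m : nat).
Hypotheses (wfF : wf_flat n F) (mF : m < size F).
Hypothesis init_step : exists t, fstep F (m, init_val) = Some (t, init_val).
Hypothesis runs : forall k, orun (fstep F) k (m, init_val) <> None.
Let M := fmodel n F.

Let nvE : nvars M = n.+1. Proof. by rewrite /nvars size_nseq. Qed.

Let cfg k : fcfg := odflt (0, init_val) (orun (fstep F) k (m, init_val)).

Let cfgS k : fstep F (cfg k) = Some (cfg k.+1).
Proof.
rewrite /cfg; have := @runs k.+1; rewrite /orun iterS -/(orun _ _ _).
by case: orun => //= c; case: (fstep F c).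
Qed.

Let cfg_lt k : (cfg k).1 < size F.
Proof.
elim: k => // k IH; have := cfgS k; have := wf_fnth wfF IH.
case: (cfg k) {IH} => pc v; rewrite /fstep /=.
case: (fnth F pc) => [z x y t|z x y t|x t t'|x t] /=.
- by case/and5P=> _ _ _ _ /andP[_ ?] [<-].
- by case/and5P=> _ _ _ _ /andP[_ ?]; case: ifP => // _ [<-].
- by case/and3P=> _ ? ? [<-] /=; case: ifP.
- by case/andP=> _ ?; case: ifP => // _ [<-].
Qed.

Definition line_lam : lm_assignment R := fun _ i => if i == 0 then 0%E else +oo%E.

Lemma line_lamP : good_lms M line_lam.
Proof.
move=> v; rewrite nvE ltnS => vn; split=> [i|i j ij]; rewrite /is_lm qsE //.
  by case: i => [|[|i]].
by case: i j ij => [|i] [|[|j]] //= _ _; apply: ltry.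
Qed.

(* [1 + 2 t - t ^ 2] increases on [[0, 1]] and its derivative vanishes at 1. *)
Definition clock_val (v : nat -> nat) (i : nat) (t : R) : R :=
  (if i is j.+1 then (v j)%:R else 1 + 2 * t - t ^+ 2)%R.

Definition clock_der (i : nat) (t : R) : R :=
  (if i is _.+1 then 0 else 2 - 2 * t)%R.

(** The constraint of the region holds from the entry on, so the counters show the values after the
    instruction, those of [cfg k.+1]. *)
Definition clock_segment k := Segment (cfg k).1 (Some 1) (fun i => i%:R%:E)
  (fun i => fstate n (if i == 0 then Inc else Std) (cfg k.+1).2)
  (fun _ => fstate n Inc (cfg k.+1).2)
  (clock_val (cfg k.+1).2) clock_der (fun _ => 0%R) (fun _ => 0%R).

Lemma clock_state (v : nat -> nat) (t : R) d :
  (0 <= t <= 1)%R -> d = dir_of (2 - 2 * t)%R ->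
  state_holds M line_lam (fstate n d v) (clock_val v ^~ t) (clock_der ^~ t).
Proof.
move=> /andP[t0 t1] Dd; split=> [|[|i]]; rewrite ?nvE /= ?size_mkseq // ltnS => i_n.
  apply/(qvalE line_lamP) => //; split; first by nra.
  by rewrite gt_eqF ?Dd //; nra.
apply/(qvalE line_lamP) => //; rewrite nth_mkseq // ler0n dir_of0 pnatr_eq0.
by [].
Qed.

Lemma clock_smooth v i (D : set R) : smooth_on D (clock_val v i) (clock_der i).
Proof.
split=> [t _|]; last first.
  apply: continuous_subspaceT => t; case: i => [|i]; last exact: cst_continuous.
  rewrite /clock_der; apply: cvgB; first exact: cvg_cst.
  by apply: cvgM; [exact: cvg_cst | exact: cvg_id].
case: i => [|i] /=; last first.
  under eq_fun do rewrite subrr mul0r.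
  exact: cvg_cst.
apply/cvgrPdist_lt => e e0; rewrite near_withinE /dnbhs near_withinE.
apply/nbhs_ballP; exists e => //= s; rewrite /ball /= => st s_neq _.
(* The difference quotient is at distance [|s - t|] from [2 - 2 * t]; hence the radius [e]. *)
suff -> : ((1 + 2 * s - s ^+ 2 - (1 + 2 * t - t ^+ 2)) / (s - t) = 2 - (s + t) :> R)%R.
  by rewrite [X in (`|X|)%R](_ : _ = s - t)%R 1?distrC //; ring.
by field; rewrite subr_eq0.
Qed.

Lemma clock_running v t : (0 < t)%R -> (t < 1)%R ->
  qval_holds M line_lam 0 (Between 0, Inc) (clock_val v 0 t) (clock_der 0 t).
Proof.
by move=> t0 t1; apply/(running_gt0 line_lamP); rewrite /clock_val /=; split; nra.
Qed.

Lemma clock_stopped v :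
  ~ qval_holds M line_lam 0 (Between 0, Inc) (clock_val v 0 1%R) (clock_der 0 1%R).
Proof. by move=> /(running_gt0 line_lamP)[_]; rewrite /=; lra. Qed.

Lemma trigger_stop pc tr x d :
  List.In tr (ftransitions n F (fnth F pc)) ->
  trigger_holds M line_lam (tr_trigger tr) x d ->
  ~ qval_holds M line_lam 0 (Between 0, Inc) (x 0) (d 0).
Proof.
case: (fnth F pc) => [z y w t|z y w t|y t u|y t] /=; try by case=> // <-.
by case=> [<-|[<-|]] //= [].
Qed.

Lemma dest_fresh k i :
  Some i != dest (fnth F (cfg k).1) -> (cfg k.+1).2 i = (cfg k).2 i.
Proof.
have := cfgS k; case: (cfg k) => pc v; rewrite /fstep /=.
case: (fnth F pc) => [z x y t|z x y t|x t t'|x t] /=.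
- by case=> <- iz; rewrite /= /updn; case: (i =P z) iz => // ->; rewrite eqxx.
- by case: ifP => // _ [<-] iz; rewrite /= /updn; case: (i =P z) iz => // ->; rewrite eqxx.
- by case=> <-.
- by case: ifP => // _ [<-].
Qed.

Lemma clock_segment_ok k : segment_ok M line_lam (clock_segment k).
Proof.
split.
- by rewrite size_map; apply: cfg_lt.
- split=> //.
  + by case=> // _; rewrite lte_fin ltr_nat.
  + split=> [|i t|i] //=.
      case=> [|[|i]] //= _; apply: clock_state; rewrite ?lexx ?ler01 //.
        by rewrite /dir_of ifT //; lra.
      by rewrite mulr1 subrr dir_of0.
    case: i => // _; rewrite !lte_fin => t0 t1.
    apply: clock_state; first by rewrite !ltW.
    by rewrite /dir_of ifT //; rewrite /= in t1; lra.
- move=> v _; split; first exact: clock_smooth.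
  by move=> _; rewrite /sg_end /=.
- move=> c; rewrite region_fmodel; last exact: cfg_lt.
  move=> /In_cat[|/In_map[i _ ->]] //.
  have := cfgS k; have := wf_fnth wfF (cfg_lt k); rewrite /clock_segment /=.
  case: (cfg k) => pc v; case: (cfg k.+1) => pc' v'; rewrite /fstep /=.
  case: (fnth F pc) => [z x y t|z x y t|x t t'|x t] //=.
  + case/and5P=> _ _ _ zx /andP[zy _] [_ <-] [<-|//]; split=> // s _ /=.
    by rewrite /updn eqxx [x == z]eq_sym [y == z]eq_sym (negPf zx) (negPf zy) natrD.
  + case/and5P=> _ _ _ zx /andP[zy _]; case: ifP => // yx [_ <-] [<-|//].
    split=> // s _ /=.
    rewrite /updn eqxx [x == z]eq_sym [y == z]eq_sym (negPf zx) (negPf zy).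
    by rewrite natrB // subrK.
  + case/andP=> xn _; case: ifP => // /eqP x0 [_ <-] [<-|//]; split=> // s _ /=.
    by rewrite x0.
- move=> tr; rewrite region_fmodel; last exact: cfg_lt.
  move=> tr_in t t0 t1 /(trigger_stop tr_in); apply.
  by apply: clock_running => //; move: t1; rewrite /sg_end /= lte_fin.
Qed.

Lemma clock_transition k : exists2 tr,
  List.In tr (rg_trans (region_of M (cfg k).1)) &
  takes_transition M line_lam tr (clock_segment k) (clock_segment k.+1).
Proof.
rewrite region_fmodel; last exact: cfg_lt.
have inh tr : tr_inh_mag tr = inherited n F (cfg k.+1).1 ->
    forall v, v \in tr_inh_mag tr ->
    val_at (clock_segment k.+1) 0%E v =
      val_at (clock_segment k) (sg_end (clock_segment k)) v.
  move=> -> v /mapP[i]; rewrite mem_filter => /andP[i_dest _] ->.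
  by rewrite /= dest_fresh.
have takes tr : tr_target tr = (cfg k.+1).1 ->
    tr_inh_mag tr = inherited n F (cfg k.+1).1 ->
    tr_inh_dir tr = [::] -> tr_assert tr = [::] ->
    trigger_holds M line_lam (tr_trigger tr)
      (val_at (clock_segment k) 1%E) (der_at (clock_segment k) 1%E) ->
    takes_transition M line_lam tr (clock_segment k) (clock_segment k.+1).
  by move=> Dt Di Dd Da tr_holds; split; rewrite ?Dd ?Da //; apply: inh.
have stopped := @clock_stopped (cfg k.+1).2.
have := cfgS k; have := wf_fnth wfF (cfg_lt k).
case Dk: (cfg k) => [pc v]; rewrite /fstep /=.
case Dpc: (fnth F pc) => [z x y t|z x y t|x t t'|x t] /=.
- by move=> _ [Dc]; eexists; [left; reflexivity | apply: takes; rewrite -?Dc].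
- move=> _; case: ifP => // _ [Dc].
  by eexists; [left; reflexivity | apply: takes; rewrite -?Dc].
- case/and3P=> xn _ _ [Dc]; case: posnP Dc => [x0|x0] Dc.
    exists (ftransition n F (TAnd stop (TPrim x.+1 (At 0, Std))) t').
      by right; left.
    apply: takes; rewrite -?Dc //; split=> //.
    by apply/(qvalE line_lamP) => //; rewrite /= -Dc /= ler0n pnatr_eq0 x0 dir_of0.
  exists (ftransition n F (TAnd stop (TPrim x.+1 (Between 0, Std))) t).
    by left.
  apply: takes; rewrite -?Dc //; split=> //.
  by apply/(qvalE line_lamP) => //; rewrite /= -Dc /= ler0n pnatr_eq0 gtn_eqF // dir_of0.
- move=> _; case: ifP => // _ [Dc].
  by eexists; [left; reflexivity | apply: takes; rewrite -?Dc].
Qed.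

Definition clock_trajectory := Trajectory line_lam clock_segment None.

Lemma clock_trajectoryP : is_trajectory (finput n F m) clock_trajectory.
Proof.
split=> //=; first exact: line_lamP.
- split=> //; have [t Dt] := init_step.
  have Dcfg : cfg 1 = (t, init_val) by rewrite /cfg [orun _ _ _]Dt.
  by rewrite Dcfg.
- by move=> k _; apply: clock_segment_ok.
- by move=> k _; split=> //; apply: clock_transition.
Qed.

Lemma size_segments a b :
  size (flatten [seq seg_all_items (clock_segment i) | i <- iota a b]) = b * 3.
Proof.
elim: b a => // b IH a.
by rewrite [LHS](size_cat (seg_all_items _)) IH size_mkseq mulSn.
Qed.

Lemma tree_infinite : ~ finite_set (behavior_tree R (finput n F m)).
Proof.
move=> /finite_seqP[s Ds].
(* Each segment contributes 3 entries, so a prefix through [j.+1] segments is longer than every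
   member of [s]. *)
pose j := \max_(l <- s) size l.
pose l := flatten [seq seg_all_items (clock_segment i) | i <- iota 0 j.+1] ++
  seg_items (clock_segment j.+1) 1.
have l_in : l \in s.
  suff : behavior_tree R (finput n F m) l by rewrite Ds.
  by exists clock_trajectory; [exact: clock_trajectoryP | exists j.+1, 1].
have : size l <= j by apply: leq_bigmax_seq.
rewrite leqNgt => /negP[]; rewrite /l size_cat size_mkseq addn1 ltnS.
by rewrite size_segments; lia.
Qed.

End InfiniteTree.

(** * A self-describing input *)

Definition env (l : seq tree) : nat -> tree := nth Leaf l.

Lemma upd_env l x t : upd (env l) x t = env (set_nth Leaf l x t).
Proof. by apply/funext => y; rewrite /env nth_set_nth. Qed.

(** Silent execution: one step count serves for every earlier output, to which nothing is added. *)
Definition wreach (c c' : seq prog * (nat -> tree)) := exists n, forall out,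
  iter n step (c.1, c.2, out) = (c'.1, c'.2, out).

Lemma wreach_refl c : wreach c c.
Proof. by exists 0. Qed.

Lemma wreach_trans c1 c2 c3 : wreach c1 c2 -> wreach c2 c3 -> wreach c1 c3.
Proof. by case=> m Hm [n Hn]; exists (n + m) => out; rewrite iterD Hm Hn. Qed.

Lemma wreach_next c1 c2 c3 :
  (forall out, step (c1.1, c1.2, out) = (c2.1, c2.2, out)) ->
  wreach c2 c3 -> wreach c1 c3.
Proof. by move=> H; apply: wreach_trans; exists 1. Qed.

Fixpoint pblock p ps := if ps is q :: ps' then PSeq p (pblock q ps') else p.

Arguments pblock : simpl never.

Lemma pblock_step p q ps k s c :
  wreach (p :: pblock q ps :: k, s) c -> wreach (pblock p (q :: ps) :: k, s) c.
Proof. exact: wreach_next. Qed.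

Lemma pblock_last p k s c :
  wreach (p :: k, s) c -> wreach (pblock p [::] :: k, s) c.
Proof. by []. Qed.

Definition exec_basic (l : seq tree) p :=
  match p with
  | PLeaf x => set_nth Leaf l x Leaf
  | PNode x y z => set_nth Leaf l x (Node (nth Leaf l y) (nth Leaf l z))
  | PLeft x y => set_nth Leaf l x (tleft (nth Leaf l y))
  | PRight x y => set_nth Leaf l x (tright (nth Leaf l y))
  | _ => l
  end.

Definition basic p :=
  match p with
  | PLeaf _ | PNode _ _ _ | PLeft _ _ | PRight _ _ => true
  | _ => false
  end.

Lemma basic_step p k l :
  basic p -> wreach (p :: k, env l) (k, env (exec_basic l p)).
Proof.
by move=> bp; exists 1 => out; case: p bp => //= *; rewrite upd_env.
Qed.

Lemma straight p ps k l :
  all basic (p :: ps) ->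
  wreach (pblock p ps :: k, env l) (k, env (foldl exec_basic l (p :: ps))).
Proof.
elim: ps p l => [|q ps IH] p l /andP[bp bps]; first exact: basic_step.
apply: pblock_step; apply: wreach_trans (basic_step _ _ bp) _; exact: IH.
Qed.

Ltac wstraight := apply: wreach_trans; [by apply: straight | rewrite /=].

Lemma while_node x p k s t1 t2 c :
  s x = Node t1 t2 ->
  wreach (p :: PWhile x p :: k, s) c -> wreach (PWhile x p :: k, s) c.
Proof. by move=> sx; apply: wreach_next => out /=; rewrite sx. Qed.

Lemma while_leaf x p k s c :
  s x = Leaf -> wreach (k, s) c -> wreach (PWhile x p :: k, s) c.
Proof. by move=> sx; apply: wreach_next => out /=; rewrite sx. Qed.

(* [false] pushes a leaf, [true] joins the two topmost trees. *)
Fixpoint postfix t : seq bool :=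
  if t is Node l r then postfix l ++ postfix r ++ [:: true] else [:: false].

Definition enc_bits := enc_seq enc_bool.

(* Registers of [fill]: 0 holds the datum, then the result; 1 a list of bits still
   to be read; 2 the stack of the parser, then the template; 5 is always [Leaf];
   9 holds the target of the next preload region, 10 the list of regions built so
   far, and 11 to 18 the components of the template. *)
Definition parse_loop := PWhile 1 (pblock (pblock (PLeft 3 1) [:: PRight 1 1; PNode 4 5 2])
  [:: PWhile 3 (pblock (PRight 6 2) [:: PLeft 7 2; PLeft 8 6; PRight 6 6;
                                       PNode 7 8 7; PNode 4 7 6; PLeaf 3]);
      pblock (PNode 6 4 5) [:: PLeft 2 6]]).

(** Generality in the remaining bits and the stack lets the runs on two subtrees compose, the right
    one being read with the left one on the stack. *)
Lemma parse_correct t bs d s a b c e :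
  exists a' b' c' e', forall k,
    wreach (parse_loop :: k,
            env [:: d; enc_bits (postfix t ++ bs); s; Leaf; a; Leaf; b; c; e])
           (parse_loop :: k,
            env [:: d; enc_bits bs; Node t s; Leaf; a'; Leaf; b'; c'; e']).
Proof.
elim: t bs s a b c e => [|l IHl r IHr] bs s a b c e.
  do 4!eexists; move=> k; apply: while_node; first reflexivity.
  apply: pblock_step; wstraight.
  apply: pblock_step; apply: while_leaf; first reflexivity.
  apply: pblock_last; wstraight.
  exact: wreach_refl.
rewrite /= -!catA.
have [a1 [b1 [c1 [e1 H1]]]] := IHl (postfix r ++ [:: true] ++ bs) s a b c e.
have [a2 [b2 [c2 [e2 H2]]]] := IHr ([:: true] ++ bs) (Node l s) a1 b1 c1 e1.
do 4!eexists; move=> k; apply: wreach_trans (H1 k) _; apply: wreach_trans (H2 k) _.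
apply: while_node; first reflexivity.
apply: pblock_step; wstraight.
apply: pblock_step; apply: while_node; first reflexivity.
wstraight.
apply: while_leaf; first reflexivity.
apply: pblock_last; wstraight.
exact: wreach_refl.
Qed.

(** Two units per bit and two more per [true] bit: the number of preload instructions. *)
Definition count_loop := PWhile 1 (pblock
  (pblock (PNode 9 5 9) [:: PNode 9 5 9; PLeft 3 1; PRight 1 1])
  [:: PWhile 3 (pblock (PNode 9 5 9) [:: PNode 9 5 9; PLeaf 3])]).

Lemma count_correct k bs m d x2 x3 x4 x6 x7 x8 l :
  wreach (count_loop :: k, env [:: d, enc_bits bs, x2, x3, x4, Leaf, x6, x7, x8,
            enc_nat m & l])
         (k, env [:: d, Leaf, x2, if nilp bs then x3 else Leaf, x4, Leaf, x6, x7, x8,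
            enc_nat (m + size (kinds bs)) & l]).
Proof.
elim: bs m x3 => [|b bs IH] m x3.
  by apply: while_leaf; [reflexivity | rewrite addn0; apply: wreach_refl].
rewrite [nilp _]/=; apply: while_node; first reflexivity.
apply: pblock_step; wstraight; apply: pblock_last.
rewrite [kinds _]/= size_cat; case: b.
  apply: while_node; first reflexivity.
  wstraight; apply: while_leaf; first reflexivity.
  have := IH m.+4 Leaf; rewrite if_same.
  by rewrite (_ : m.+4 + _ = m + (size (kinds bs) + 4)) //; lia.
apply: while_leaf; first reflexivity.
have := IH m.+2 Leaf; rewrite if_same.
by rewrite (_ : m.+2 + _ = m + (size (kinds bs) + 2)) //; lia.
Qed.

(** Encoding of a preload region: [kt] pairs its constraint list with the part of its transition
    that follows the target [c]. *)
Definition piece trig kt c :=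
  Node Leaf (Node (tleft kt)
    (Node (Node (Node Leaf (Node trig (Node c (tright kt)))) Leaf) Leaf)).

Definition emit i := pblock (PRight 6 i) [:: PNode 6 9 6; PNode 6 15 6; PNode 6 5 6;
  PNode 6 6 5; PNode 6 6 5; PLeft 7 i; PNode 6 7 6; PNode 6 5 6; PNode 10 6 10;
  PRight 9 9].

(** Regions are consed from last to first with targets counting down. Bits are read in order,
    because [kinds] puts the instructions of the first bit last. *)
Definition build_loop := PWhile 1 (pblock (pblock (PLeft 3 1) [:: PRight 1 1])
  [:: PWhile 3 (pblock (emit 14) [:: emit 13; PLeaf 3]); emit 12; emit 11]).

Section Emit.
Variables (trig : tree) (kt : nat * nat * nat -> tree).

Fixpoint emits m ks out :=
  if ks is i :: ks' then
    Node (piece trig (kt i) (enc_nat m.+1)) (emits m.+1 ks' out)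
  else out.

Lemma emits_cat m ks1 ks2 out :
  emits m (ks1 ++ ks2) out = emits m ks1 (emits (m + size ks1) ks2 out).
Proof.
elim: ks1 m => [|i ks1 IH] m; first by rewrite addn0.
by rewrite /= IH addSnnS.
Qed.

Lemma build_correct bs m d x2 x4 x6 x7 x8 out l :
  exists x6' x7', forall k,
  wreach (build_loop :: k, env [:: d, enc_bits bs, x2, Leaf, x4, Leaf, x6, x7, x8,
            enc_nat (m + size (kinds bs)), out, kt (2, 8, 8), kt (8, 2, 1),
            kt (2, 8, 0), kt (8, 2, 2), trig & l])
         (k, env [:: d, Leaf, x2, Leaf, x4, Leaf, x6', x7', x8,
            enc_nat m, emits m (kinds bs) out, kt (2, 8, 8), kt (8, 2, 1),
            kt (2, 8, 0), kt (8, 2, 2), trig & l]).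
Proof.
elim: bs out x6 x7 => [|b bs IH] out x6 x7.
  exists x6, x7 => k; apply: while_leaf; first reflexivity.
  by rewrite addn0; apply: wreach_refl.
rewrite [kinds _]/= !size_cat !emits_cat.
(* Address of the first preload instruction for [b], after those for [bs]. *)
pose M := m + size (kinds bs).
have [x6' [x7' H]] := IH (emits M [:: (2, 8, 8); (8, 2, 1)]
    (emits (M + 2) (if b then [:: (2, 8, 0); (8, 2, 2)] else [::]) out))
    (piece trig (kt (2, 8, 8)) (enc_nat M.+1)) (tleft (kt (2, 8, 8))).
exists x6', x7' => k; move: {H}(H k) => H; apply: while_node; first reflexivity.
rewrite /emit; apply: pblock_step; wstraight.
case: b H => H.
  rewrite (_ : m + _ = M.+4); last by rewrite /M /=; lia.
  apply: pblock_step; apply: while_node; first reflexivity.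
  apply: pblock_step; wstraight.
  apply: pblock_step; wstraight.
  wstraight.
  apply: while_leaf; first reflexivity.
  apply: pblock_step; wstraight.
  apply: pblock_last; wstraight.
  by move: H; rewrite /= addn2.
rewrite (_ : m + _ = M.+2); last by rewrite /M /=; lia.
apply: pblock_step; apply: while_leaf; first reflexivity.
apply: pblock_step; wstraight.
apply: pblock_last; wstraight.
exact: H.
Qed.
End Emit.

Definition append_loop :=
  PWhile 16 (pblock (PLeft 6 16) [:: PNode 10 6 10; PRight 16 16]).

Lemma append_correct s x0 x1 x2 x3 x4 x6 x7 x8 x9 out x11 x12 x13 x14 x15 l :
  exists x6', forall k,
  wreach (append_loop :: k, env [:: x0, x1, x2, x3, x4, Leaf, x6, x7, x8, x9, out,
            x11, x12, x13, x14, x15, enc_seq id (rev s) & l])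
         (k, env [:: x0, x1, x2, x3, x4, Leaf, x6', x7, x8, x9, foldr Node out s,
            x11, x12, x13, x14, x15, Leaf & l]).
Proof.
have -> : foldr Node out s = foldl (fun o x => Node x o) out (rev s) by rewrite foldl_rev.
elim: (rev s) x6 out => [|x s' IH] x6 out.
  by exists x6 => k; apply: while_leaf; [reflexivity | apply: wreach_refl].
have [x6' H] := IH x (Node x out).
exists x6' => k; apply: while_node; first reflexivity.
by wstraight; apply: H.
Qed.

(** The datum is copied to register 1 three times: for parsing, counting and building. At the end
    every register but 0 is reset, so that the next program starts as in a fresh run. *)
Definition fill := pblock (pblock (PNode 6 0 5) [:: PLeft 1 6]) [:: parse_loop;
  pblock (PLeft 2 2) [::
    PLeft 9 2; PRight 2 2; PLeft 10 2; PRight 2 2; PLeft 11 2; PRight 2 2;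
    PLeft 12 2; PRight 2 2; PLeft 13 2; PRight 2 2; PLeft 14 2; PRight 2 2;
    PLeft 15 2; PRight 2 2; PLeft 16 2; PRight 2 2; PLeft 17 2; PRight 2 2;
    PLeft 18 2; PNode 6 0 5; PLeft 1 6];
  count_loop;
  pblock (PNode 6 0 5) [:: PLeft 1 6];
  build_loop;
  append_loop;
  pblock (PNode 6 10 5) [:: PNode 6 17 6; PNode 6 5 6; PNode 6 6 18; PNode 0 5 6;
    PLeaf 1; PLeaf 2; PLeaf 3; PLeaf 4; PLeaf 6; PLeaf 7; PLeaf 8; PLeaf 9; PLeaf 10;
    PLeaf 11; PLeaf 12; PLeaf 13; PLeaf 14; PLeaf 15; PLeaf 16; PLeaf 17; PLeaf 18]].

Definition template m out kt trig base vars tail :=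
  enc_seq id [:: enc_nat m; out; kt (2, 8, 8); kt (8, 2, 1); kt (2, 8, 0); kt (8, 2, 2);
    trig; enc_seq id (rev base); vars; tail].

Lemma env_pad l i : env (l ++ nseq i Leaf) = env l.
Proof.
apply/funext => j; rewrite /env nth_cat; case: ltnP => // le_lj.
by rewrite nth_nseq if_same nth_default.
Qed.

Lemma env_upd0 t : upd (fun=> Leaf) 0 t = env [:: t].
Proof. by apply/funext => -[|[|j]]. Qed.

Lemma fill_correct k m out kt trig base vars tail :
  let bs := postfix (template m out kt trig base vars tail) in
  wreach (fill :: k, upd (fun=> Leaf) 0 (enc_bits bs))
    (k, upd (fun=> Leaf) 0 (Node Leaf (Node (Node Leaf (Node vars
          (Node (foldr Node (emits trig kt m (kinds bs) out) base) Leaf))) tail))).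
Proof.
move=> bs; rewrite !env_upd0.
set d := enc_bits bs.
(* Nine explicit registers, the shape expected by [parse_correct]. *)
rewrite -[env [:: d]](env_pad _ 8) [_ ++ _]/=.
apply: pblock_step; wstraight.
apply: pblock_step.
pose T := template m out kt trig base vars tail.
have [a1 [a2 [a3 [a4 H]]]] :=
  parse_correct T [::] d Leaf Leaf (Node d Leaf) Leaf Leaf.
rewrite cats0 in H; apply: wreach_trans (H _) _.
apply: while_leaf; first reflexivity.
apply: pblock_step; wstraight.
apply: pblock_step; apply: wreach_trans (count_correct _ _ _ _ _ _ _ _ _ _ _) _.
rewrite if_same.
apply: pblock_step; wstraight.
have [b1 [b2 {}H]] := build_correct trig kt bs m d (Node tail Leaf) a1 (Node d Leaf) a3 a4
  out [:: enc_seq id (rev base); vars; tail].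
apply: pblock_step; apply: wreach_trans (H _) _.
have [b3 {}H] := append_correct base d Leaf (Node tail Leaf) Leaf a1 b1 b2 a4
  (enc_nat m) (emits trig kt m (kinds bs) out) (kt (2, 8, 8)) (kt (8, 2, 1))
  (kt (2, 8, 0)) (kt (8, 2, 2)) trig [:: vars; tail].
apply: pblock_step; apply: wreach_trans (H _) _.
apply: pblock_last; wstraight; rewrite -(env_pad [:: _] 18); exact: wreach_refl.
Qed.

(* The preload instructions assign counters 2 and 8 in turn, so the counter that is
   not inherited by the next region is known from the current one. *)
Definition next_dest z := if z == 2 then 8 else 2.

(** The empty list asks for 2, the target of the closing instruction of [chain]. *)
Fixpoint alternating z (ks : seq (nat * nat * nat)) :=
  if ks is (z', _, _) :: ks' then (z == z') && alternating (next_dest z') ks'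
  else z == 2.

Lemma alternating_cat z ks1 ks2 :
  alternating z ks1 -> alternating 2 ks2 -> alternating z (ks1 ++ ks2).
Proof.
elim: ks1 z => [|[[z' x] y] ks1 IH] z /=; first by move=> /eqP->.
by case/andP=> -> alt1 alt2; apply: IH.
Qed.

Lemma alternating_kinds bs : alternating 2 (kinds bs).
Proof. by elim: bs => //= b bs IH; apply: alternating_cat IH _; case: b. Qed.

(** Everything in the encoding of a preload region except trigger and jump target. The inheritance
    list comes from [next_dest], so the template does not depend on the datum. *)
Definition step_template n (k : nat * nat * nat) :=
  let: (z, x, y) := k in
  Node (enc_seq enc_constr
          (fconstr (FAdd z x y 0) ++ [seq CConst j.+1 None [::] | j <- iota 0 n]))
    (Node (enc_seq enc_nat [seq i.+1 | i <- iota 0 n & Some i != Some (next_dest z)])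
       (Node Leaf (Node Leaf Leaf))).

Definition last_piece n F := Node (enc_region (fregion n F (FAdd 2 8 8 0))) Leaf.

Lemma chain_dest F m ks z :
  drop m F = chain m ks -> alternating z ks -> dest (fnth F m) = Some z.
Proof.
move=> Dm; rewrite /fnth -[m in nth _ _ m]addn0 -nth_drop Dm.
by case: ks {Dm} => [|[[z' x] y] ks] /=; [move=> /eqP-> | case/andP=> /eqP->].
Qed.

Lemma enc_chain n F m ks z :
  drop m F = chain m ks -> alternating z ks ->
  enc_seq enc_region (map (fregion n F) (chain m ks)) =
    emits (enc_trigger stop) (step_template n) m ks (last_piece n F).
Proof.
elim: ks m z => [//|[[z' x] y] ks IH] m z Dm /= /andP[_ alt].
have Dm1 : drop m.+1 F = chain m.+1 ks by rewrite -[m.+1]add1n -drop_drop Dm /= drop0.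
congr Node; last exact: IH Dm1 alt.
by rewrite /enc_region /enc_transition /= /inherited (chain_dest Dm1 alt).
Qed.

(** Jumps of [i] stay inside [F1], so appending the preload chain leaves the region unchanged. *)
Lemma fregion_cat n F1 F2 i :
  wf_finstr n (size F1) i -> fregion n (F1 ++ F2) i = fregion n F1 i.
Proof.
have inh t : t < size F1 -> inherited n (F1 ++ F2) t = inherited n F1 t.
  by move=> lt_t; rewrite /inherited /fnth nth_cat lt_t.
rewrite /fregion /ftransitions /ftransition.
case: i => [z x y t|z x y t|x t u|x t] /=.
- by case/and5P=> _ _ _ _ /andP[_ /inh->].
- by case/and5P=> _ _ _ _ /andP[_ /inh->].
- by case/and3P=> _ /inh-> /inh->.
- by case/andP=> _ /inh->.
Qed.

Lemma enc_seq_cat T (f : T -> tree) s1 s2 :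
  enc_seq f (s1 ++ s2) = foldr Node (enc_seq f s2) (map f s1).
Proof. by elim: s1 => //= x s1 ->. Qed.

Lemma map_fregion_cat n F1 F2 s :
  all (wf_finstr n (size F1)) s ->
  map (fregion n (F1 ++ F2)) s = map (fregion n F1) s.
Proof. by elim: s => //= i s IH /andP[wfi /IH->]; rewrite fregion_cat. Qed.

Definition vars_tree n := enc_seq enc_qspace (nseq n.+1 half_line).
Definition regions_tree n F := [seq enc_region i | i <- map (fregion n F) F].
Definition start_tree n (F : seq finstr) :=
  Node (enc_nat (size F)) (Node (enc_state (fstate n Inc init_val)) Leaf).

(** The right-hand side is what [fill] assembles. Apart from [ks] it depends only on [n] and [F], so
    the template is fixed before the datum and there is no circularity. *)
Lemma enc_finput n F ks :
  0 < size F -> 8 < n -> wf_flat n F -> alternating 2 ks ->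
  enc_input (finput n (F ++ chain (size F) ks) (size F)) =
  Node Leaf (Node (Node Leaf (Node (vars_tree n)
    (Node (foldr Node (emits (enc_trigger stop) (step_template n)
             (size F) ks (last_piece n F)) (regions_tree n F)) Leaf)))
    (start_tree n F)).
Proof.
move=> F_gt0 n_gt8 wfF alt; set F' := F ++ _.
have -> : last_piece n F = last_piece n F'.
  by rewrite /last_piece fregion_cat //= F_gt0 n_gt8 !(ltn_trans _ n_gt8).
rewrite -(enc_chain n (F := F') _ alt) ?drop_size_cat // -enc_seq_cat.
by rewrite -(map_fregion_cat (chain (size F) ks) wfF) -map_cat.
Qed.

(* Keeps simplification from expanding the flat code of [fill]. *)
Opaque fill.

(** * The fixed point and the contradiction *)

Section Diagonal.
Variable A : prog.

Definition self_prog := PSeq fill A.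
Definition self_size := regbound self_prog + 8.
Definition self_code := fcode (comp self_prog).
Definition self_bits := postfix (template (size self_code) (last_piece self_size self_code)
  (step_template self_size) (enc_trigger stop) (regions_tree self_size self_code)
  (vars_tree self_size) (start_tree self_size self_code)).
Definition self_flat := fprog (comp self_prog) self_bits.
Definition self_input := finput self_size self_flat (size self_code).

Lemma self_size_gt8 : 8 < self_size.
Proof. by rewrite /self_size /self_prog /= addnC -{1}[8]addn0 ltn_add2l leq_max. Qed.

Lemma wf_self_prog : wf_cstmt self_size (comp self_prog).
Proof. exact: wf_comp. Qed.

Lemma wf_self_flat : wf_flat self_size self_flat.
Proof. exact: wf_fprog self_size_gt8 wf_self_prog. Qed.

Lemma self_start : size self_code < size self_flat.
Proof. by rewrite size_cat size_chain addnS ltnS leq_addr. Qed.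

(** After silent steps that unfold [PSeq] and run [fill], the computation is that of [A] started
    afresh on the encoding of [self_input]. *)
Lemma self_output :
  exists N, forall k, output self_prog (enc_seq enc_bool self_bits) (k + N) =
                      output A (enc_input self_input) k.
Proof.
have code_gt0 : 0 < size self_code by rewrite size_map size_rcons.
have wf_code : wf_flat self_size self_code.
  exact: wf_fcode (ltn_trans (isT : 0 < 8) self_size_gt8) wf_self_prog.
rewrite /self_input /self_flat /fprog -/self_code enc_finput ?alternating_kinds //;
  last exact: self_size_gt8.
have [N HN] := fill_correct [:: A] (size self_code) (last_piece self_size self_code)
  (step_template self_size) (enc_trigger stop) (regions_tree self_size self_code)
  (vars_tree self_size) (start_tree self_size self_code).
exists N.+1 => k; rewrite /output /run addnS iterSr iterD.
by congr ((iter k step _).2); apply: HN.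
Qed.

Lemma self_stuck :
  (exists k, orun (fstep self_flat) k (size self_code, init_val) = None) <->
  (exists k, first_node (output A (enc_input self_input) k)).
Proof.
have [N HN] := self_output; rewrite fprog_stuck; split=> -[k Hk].
  exists k; rewrite -HN; have [out ->] := output_prefix self_prog
    (enc_seq enc_bool self_bits) (leq_addr N k).
  by case: (output _ _ k) Hk => // -[].
by exists (k + N); rewrite HN.
Qed.

(** The initial state must show the counters after the first instruction. That instruction sets
    counter 2 to twice counter 8, which is 0, so [init_val] is right. *)
Lemma self_init_step :
  exists t, fstep self_flat (size self_code, init_val) = Some (t, init_val).
Proof.
have [t Dt] : exists t, fnth self_flat (size self_code) = FAdd 2 8 8 t.
  rewrite /fnth nth_cat ltnn subnn; elim: self_bits => [|b bs [t IH]]; first by exists 0.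
  rewrite /=; case: (kinds bs) IH => [|[[z x] y] ks] /= IH; first by eexists.
  by exists t.
exists t; rewrite /fstep Dt; congr (Some (_, _)).
by apply/funext => -[|[|[|i]]].
Qed.

End Diagonal.

Theorem theorem5 (R : realType) :
  ~ exists A : prog, forall I : qinput,
      wf_input I -> add_const_only (in_model I) -> sound_complete_on R A I.
Proof.
case=> A correct.
have [empty _ infinite] := correct (self_input A)
  (wf_finput (wf_self_flat A) (self_start A)) (add_const_fmodel _ _).
have [stuck|runs] := pselect (exists k,
    orun (fstep (self_flat A)) k (size (self_code A), init_val) = None).
  have size_gt1 : 1 < self_size A := ltn_trans (isT : 1 < 8) (self_size_gt8 A).
  have [n _ Dn] := empty (tree_empty R (wf_self_flat A) size_gt1 stuck).
  have [k Hk] := (self_stuck A).1 stuck.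
  (* Both outputs are prefixes of the one at the later time, whose first tree would be [Leaf] and a
     [Node] at once. *)
  have [out1 D1] := output_prefix A (enc_input (self_input A)) (leq_maxl n k).
  have [out2 D2] := output_prefix A (enc_input (self_input A)) (leq_maxr n k).
  move: D2; rewrite D1 Dn; case: (output A _ k) Hk => [|[|? ?] ?] //.
have runs' k : orun (fstep (self_flat A)) k (size (self_code A), init_val) <> None.
  by move=> Hk; apply: runs; exists k.
have [_ [nodes [Dout grows _ root _]]] := infinite
  (tree_infinite (wf_self_flat A) (self_start A) (self_init_step A) runs').
have [n n_gt0] := grows 1.
(* The root is a nonempty behavior, hence encoded by a [Node]; printing it first makes the machine
   stuck. *)
apply: runs; apply/self_stuck; exists n; rewrite Dout.
by case: (size _) n_gt0 => //= s _; rewrite root.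
Qed.
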